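(* Let $(\mathfrak n,\omega)$ be a $6$-dimensional real three-step nilpotent Lie algebra equipped with a symplectic structure $\omega$, and let $\langle\cdot,\cdot\rangle$ be a minimal compatible metric on $(\mathfrak n,\omega)$, with $J$ defined by $\omega(X,Y)=\langle JX,Y\rangle$. Then $(\langle\cdot,\cdot\rangle,J,\omega)$ is a soliton almost Kähler structure on $\mathfrak n$.
   Context: Let $\mathfrak g$ be a finite-dimensional real Lie algebra. A symplectic structure on $\mathfrak g$ is a non-degenerate skew-symmetric bilinear form $\omega$ that is closed: $\omega([X,Y],Z)+\omega([Y,Z],X)+\omega([Z,X],Y)=0$ for all $X,Y,Z\in\mathfrak g$. An inner product $\langle\cdot,\cdot\rangle$ on $\mathfrak g$ is compatible with $(\mathfrak g,\omega)$ if the endomorphism $J$ defined by $\omega(X,Y)=\langle JX,Y\rangle$ satisfies $J^2=-\mathrm{Id}$; then $(\langle\cdot,\cdot\rangle,J,\omega)$ is called an almost Kähler structure on $\mathfrak g$. It corresponds to a left-invariant almost Kähler structure on the simply connected Lie group with Lie algebra $\mathfrak g$. $\mathrm{Ric}$ and $\mathrm{sc}$ denote the Ricci operator and scalar curvature of the left-invariant Riemannian metric defined by the inner product, at the identity. $T^{t}$ is the transpose of $T\in\mathrm{End}(\mathfrak g)$ with respect to $\langle\cdot,\cdot\rangle$. Put $T^{c}=\frac12(T-JTJ)$ and $T^{ac}=\frac12(T+JTJ)$ (complexified and anti-complexified parts). The Chern-Ricci form is $p(X,Y)=\frac12\left(\mathrm{tr}(\mathrm{ad}_{J[X,Y]})-\mathrm{tr}(J\,\mathrm{ad}_{[X,Y]})\right)$,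 and the Chern-Ricci operator $P$ is defined by $p(X,Y)=\omega(PX,Y)$ for all $X,Y\in\mathfrak g$. The almost Kähler structure is called soliton (for the symplectic curvature flow) if there are $c\in\mathbb R$ and a derivation $D$ of $\mathfrak g$ such that $P=c\,\mathrm{Id}+\frac12(D-JD^{t}J)$ and $P^{c}+\mathrm{Ric}^{ac}=c\,\mathrm{Id}+\frac12(D+D^{t})$. For nilpotent $\mathfrak g$, a compatible metric $\langle\cdot,\cdot\rangle$ on $(\mathfrak g,\omega)$ is called minimal if $\mathrm{tr}\big((\mathrm{Ric}^{ac})^2\big)$ attains at $\langle\cdot,\cdot\rangle$ its minimum among all inner products compatible with $(\mathfrak g,\omega)$ having the same scalar curvature as $\langle\cdot,\cdot\rangle$ (the anti-complexified part being taken, for each compatible inner product, with respect to its own $J$). *)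

(* Defs.v *)
From HB Require Import structures.
From mathcomp Require Import all_boot all_order all_algebra ring.
From mathcomp Require Import boolp classical_sets reals.

Set Implicit Arguments.
Unset Strict Implicit.
Unset Printing Implicit Defensive.

Import Order.TTheory GRing.Theory Num.Theory.
Local Open Scope ring_scope.

(* The endomorphism A determined by h(x, y) = b(A x, y); it exists and is
   unique when b is non-degenerate and h bilinear (operator_ofP,
   operator_of_eq), and is 0 if there is no such A. *)
Definition operator_of (R : realType) (V : vectType R) (b h : V -> V -> R) :
    'End(V) :=
  xget 0 [set A : 'End(V) | forall x y, h x y = b (A x) y]%classic.

Section OperatorOf.
Variables (R : realType) (V : vectType R).

Lemma operator_ofP (eps : bool) (b : {hermitian V for eps & idfun})
    (h : V -> V -> R) :
  nondegenerate b -> bilinear_for *%R *%R h ->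
  forall x y, h x y = b (operator_of b h x) y.
Proof.
move=> b_nd [hl hr].
suff [A hA] : exists A : 'End(V), forall x y, h x y = b (A x) y.
  move=> x y; rewrite /operator_of; case: xgetP => [B _ /= -> //|].
  by move=> /(_ A) /= nA; case: nA.
have bl x : linear (b x : V -> R^o).
  by move=> c u v; exact: linearPr.
have hrl x : linear (h x : V -> R^o) by move=> c u v; rewrite hr.
pose bL x : {linear V -> R^o} := HB.pack (b x : V -> R^o)
  (GRing.isLinear.Build R V R^o _ _ (bl x)).
pose hL x : {linear V -> R^o} := HB.pack (h x : V -> R^o)
  (GRing.isLinear.Build R V R^o _ _ (hrl x)).
have Phil : linear (fun x => linfun (bL x) : 'Hom(V, R^o)).
  move=> c u v; apply/lfunP => y; rewrite add_lfunE scale_lfunE !lfunE /=.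
  exact: linearPl.
have Hl : linear (fun x => linfun (hL x) : 'Hom(V, R^o)).
  move=> c u v; apply/lfunP => y; rewrite add_lfunE scale_lfunE !lfunE /=.
  exact: hl.
pose PhiL : {linear V -> 'Hom(V, R^o)} := HB.pack
  (fun x => linfun (bL x) : 'Hom(V, R^o))
  (GRing.isLinear.Build R V 'Hom(V, R^o) _ _ Phil).
pose HL : {linear V -> 'Hom(V, R^o)} := HB.pack
  (fun x => linfun (hL x) : 'Hom(V, R^o))
  (GRing.isLinear.Build R V 'Hom(V, R^o) _ _ Hl).
pose Phi := linfun PhiL.
have ker0 : lker Phi = 0%VS.
  apply/eqP; rewrite -subv0; apply/subvP => x; rewrite memv_ker => /eqP Phix.
  move: b_nd => /eqP <-; apply/mem_orthovP => y _.
  have := congr1 (fun f : 'Hom(V, R^o) => f y) Phix.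
  by rewrite zero_lfunE /= !lfunE.
have imT : limg Phi = fullv.
  apply/eqP; rewrite eqEdim subvf /=.
  rewrite (limg_dim_eq (U := fullv)) ?ker0 ?capv0 //.
  by rewrite !dimvf /= /dim /= muln1.
exists (Phi^-1 \o linfun HL)%VF => x y.
have : Phi ((Phi^-1 \o linfun HL)%VF x) = linfun HL x.
  by rewrite comp_lfunE limg_lfunVK // imT memvf.
move=> /(congr1 (fun f : 'Hom(V, R^o) => f y)).
have PhiE v : Phi v y = b v y by rewrite !lfunE.
by rewrite PhiE => ->; rewrite !lfunE.
Qed.

Lemma operator_of_eq (eps : bool) (b : {hermitian V for eps & idfun})
    (h : V -> V -> R) (A : 'End(V)) :
  nondegenerate b -> (forall x y, h x y = b (A x) y) -> operator_of b h = A.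
Proof.
move=> b_nd hA; apply: xget_unique => // B hB; apply/lfunP => x.
apply/eqP; rewrite -subr_eq0 -memv0 -(eqP b_nd); apply/mem_orthovP => y _.
by rewrite linearBl /= -hA -hB subrr.
Qed.

Lemma dot_nondegenerate (g : {dot V for idfun}) : nondegenerate g.
Proof.
rewrite /nondegenerate -subv0; apply/subvP => x /mem_orthovP /(_ x (memvf x)).
move=> gxx; rewrite memv0; apply/negPn/negP => /(neq0_dnorm_gt0 (s:=g)).
by rewrite gxx ltxx.
Qed.

End OperatorOf.

Definition lftrace (R : realType) (V : vectType R) (f : 'End(V)) : R :=
  \tr (passmx.mxof (vbasis {:V}) (vbasis {:V}) f).

Section LieAlgebra.
Variables (R : realType) (V : vectType R) (br : {bilinear V -> V -> V}).
Implicit Types X Y Z : V.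

Definition lie_bracket : Prop :=
  (forall X, br X X = 0) /\
  (forall X Y Z, br X (br Y Z) + br Y (br Z X) + br Z (br X Y) = 0).

Lemma bracketC X Y : lie_bracket -> br Y X = - br X Y.
Proof.
move=> [brxx _]; apply/eqP; rewrite -addr_eq0; apply/eqP.
by have := brxx (X + Y); rewrite linearDl !linearDr /= !brxx add0r addr0 addrC.
Qed.

Definition ad X : 'End(V) := linfun (br X).

Lemma adE X Y : ad X Y = br X Y.
Proof. by rewrite lfunE. Qed.

Lemma ad_linear : linear ad.
Proof.
by move=> c X Y; apply/lfunP => Z; rewrite add_lfunE scale_lfunE !adE linearPl.
Qed.

Definition derivation (D : 'End(V)) : Prop :=
  forall X Y, D (br X Y) = br (D X) Y + br X (D Y).

Definition br_space (U W : {vspace V}) : {vspace V} :=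
  <<[seq br u w | u <- vbasis U, w <- vbasis W]>>%VS.

Lemma mem_br_space (U W : {vspace V}) u w :
  u \in U -> w \in W -> br u w \in br_space U W.
Proof.
move=> /coord_vbasis -> /coord_vbasis ->.
rewrite linear_sumlz rpred_sum // => i _; rewrite linear_sumr rpred_sum // => j _.
rewrite linearZl_LR linearZr_LR /= !rpredZ // memv_span //.
by apply: allpairs_f; rewrite mem_nth // size_tuple.
Qed.

Definition lower_central (k : nat) : {vspace V} :=
  iter k (br_space fullv) fullv.

Definition step_nilpotent (k : nat) : Prop :=
  lower_central k = 0%VS /\
  forall j, (j < k)%N -> lower_central j <> 0%VS.

End LieAlgebra.

Section LeftInvariantMetric.
Variables (R : realType) (V : vectType R) (br : {bilinear V -> V -> V}).
Variable g : {dot V for idfun}.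
Implicit Types X Y Z : V.

Definition lftranspose (T : 'End(V)) : 'End(V) :=
  operator_of g (fun X Y => g X (T Y)).

Lemma lftransposeE (T : 'End(V)) X Y : g (lftranspose T X) Y = g X (T Y).
Proof.
rewrite -(operator_ofP (dot_nondegenerate g)) //.
by split=> Z c U W; rewrite ?linearP ?linearPl ?linearPr.
Qed.

(* The Koszul formula on left-invariant vector fields, where the derivatives of
   the constant functions g(X, Y) vanish. *)
Definition koszul X Y Z : R :=
  2^-1 * (g (br X Y) Z - g (br Y Z) X + g (br Z X) Y).

(* The Levi-Civita connection: nabla X Y is the covariant derivative of Y
   along X. *)
Definition nabla X : 'End(V) := operator_of g (koszul X).

Lemma nablaE X Y Z : koszul X Y Z = g (nabla X Y) Z.
Proof.
apply: (operator_ofP (h := koszul X) (dot_nondegenerate g)).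
by split=> Y0 c U W; rewrite /koszul linearPl ?linearPr linearPl ?linearPr;
  rewrite ?linearPl ?linearPr /=; ring.
Qed.

Lemma nabla_torsion_free X Y :
  lie_bracket br -> nabla X Y - nabla Y X = br X Y.
Proof.
move=> lie; have brC U W := bracketC U W lie.
apply/eqP; rewrite -subr_eq0 -memv0 -(eqP (dot_nondegenerate g)).
apply/mem_orthovP => Z _.
rewrite !linearBl /= -!nablaE /koszul (brC X Y) (brC Z X) (brC Y Z) !linearNl /=.
by field.
Qed.

Lemma nabla_metric X Y Z :
  lie_bracket br -> g (nabla X Y) Z + g Y (nabla X Z) = 0.
Proof.
move=> lie; have brC U W := bracketC U W lie.
rewrite (hermitian_subproof (s := g) Y) expr0 mul1r /= -!nablaE /koszul.
rewrite (brC X Y) (brC Z X) (brC Y Z) !linearNl /=.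
by field.
Qed.

Definition curvature X Y : 'End(V) :=
  (nabla X \o nabla Y)%VF - (nabla Y \o nabla X)%VF - nabla (br X Y).

Definition ricci_form Y Z : R := lftrace (linfun (fun X => curvature X Y Z)).

Let lin2B c (a b a' b' : V) :
  c *: a + a' - (c *: b + b') = c *: (a - b) + (a' - b').
Proof. by rewrite opprD addrACA scalerBr. Qed.

Lemma nabla_linear : linear nabla.
Proof.
move=> c X Y; apply: operator_of_eq (dot_nondegenerate g) _ => Z W.
rewrite add_lfunE scale_lfunE.
transitivity (c * g (nabla X Z) W + g (nabla Y Z) W); last by rewrite linearPl.
rewrite -!nablaE /koszul.
by rewrite !(linearPl, linearPr) /=; ring.
Qed.

Lemma curvature_linear Y Z : linear (fun X => curvature X Y Z).
Proof.
move=> c X X'; rewrite /curvature linearPl !nabla_linear.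
rewrite !(add_lfunE, opp_lfunE, comp_lfunE, scale_lfunE) linearP.
by rewrite /= !lin2B.
Qed.

Definition Ric : 'End(V) := operator_of g ricci_form.

Lemma lftrace_linear : linear_for *%R (@lftrace R V).
Proof. by move=> c f h; rewrite /lftrace passmx.mxof_linear mxtraceD mxtraceZ. Qed.

Lemma ricci_formE X Y : ricci_form X Y = g (Ric X) Y.
Proof.
have curvE U W T : linfun (fun X => curvature X U W) T = curvature T U W.
  pose L : {linear V -> V} := HB.pack (fun X => curvature X U W)
    (GRing.isLinear.Build R V V _ _ (curvature_linear U W)).
  exact: (lfunE L).
apply: (operator_ofP (h := ricci_form) (dot_nondegenerate g)).
split=> U c W T; rewrite /ricci_form -lftrace_linear; congr lftrace;
  apply/lfunP => S; rewrite add_lfunE scale_lfunE !curvE; first last.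
  exact: linearP.
rewrite /curvature linearPr !nabla_linear.
rewrite !(add_lfunE, opp_lfunE, comp_lfunE, scale_lfunE) linearP.
by rewrite /= !lin2B.
Qed.

Definition scal : R := lftrace Ric.

End LeftInvariantMetric.

Section AlmostKahler.
Variables (R : realType) (V : vectType R) (br : {bilinear V -> V -> V}).
Variable omega : {skew_symmetric V}.
Implicit Types (X Y Z : V) (g : {dot V for idfun}) (J T : 'End(V)).

Definition closed_form : Prop :=
  forall X Y Z,
    omega (br X Y) Z + omega (br Y Z) X + omega (br Z X) Y = 0.

Definition symplectic : Prop := nondegenerate omega /\ closed_form.

Definition Jof g : 'End(V) := operator_of g omega.

Lemma JofE g X Y : omega X Y = g (Jof g X) Y.
Proof.
apply: (operator_ofP (h := omega) (dot_nondegenerate g)).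
by split=> Z c U W; rewrite ?linearPl ?linearPr.
Qed.

Definition compatible g : Prop := (Jof g \o Jof g)%VF = - \1%VF.

Definition almost_kahler g : Prop := symplectic /\ compatible g.

Definition cpart J T : 'End(V) := 2^-1 *: (T - (J \o T \o J)%VF).

Definition acpart J T : 'End(V) := 2^-1 *: (T + (J \o T \o J)%VF).

Definition chern_ricci_form J X Y : R :=
  2^-1 * (lftrace (ad br (J (br X Y))) - lftrace (J \o ad br (br X Y))%VF).

Definition chern_ricci J : 'End(V) := operator_of omega (chern_ricci_form J).

Lemma chern_ricciE J X Y :
  nondegenerate omega ->
  chern_ricci_form J X Y = omega (chern_ricci J X) Y.
Proof.
move=> nd; apply: (operator_ofP (h := chern_ricci_form J) nd).
split=> Z c U W; rewrite /chern_ricci_form ?linearPl ?linearPr linearP !ad_linear;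
  rewrite comp_lfunDr -comp_lfunZr !lftrace_linear /=; ring.
Qed.

Definition Ric_ac g : 'End(V) := acpart (Jof g) (Ric br g).

Definition soliton g : Prop :=
  almost_kahler g /\
  let J := Jof g in
  let P := chern_ricci J in
  exists (c : R) (D : 'End(V)),
    [/\ derivation br D,
        P = c *: \1%VF + 2^-1 *: (D - (J \o lftranspose g D \o J)%VF) &
        cpart J P + Ric_ac g = c *: \1%VF + 2^-1 *: (D + lftranspose g D)].

Definition minimal g : Prop :=
  compatible g /\
  forall g' : {dot V for idfun},
    compatible g' -> scal br g' = scal br g ->
    lftrace (Ric_ac g \o Ric_ac g)%VF <= lftrace (Ric_ac g' \o Ric_ac g')%VF.

End AlmostKahler.

(* Main.v *)
(** The Chern-Ricci operator P satisfies omega(PX,Y) = theta([X,Y]) with theta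
    linear and zero on the center, so P is omega-symmetric. If P is a derivation and
    Ric^ac + lambda is a derivation, then D = Ric^ac + lambda + P solves both soliton
    equations with c = -lambda.

    Structure. In a 6-dimensional three-step symplectic Lie algebra [n,n] is spanned
    by one vector zeta modulo central vectors. This yields a Darboux basis e_i, f_j
    such that the f_j span a Lagrangian ideal containing [n,n] and only zeta among the
    f_j is not central. In such a basis P is seen to be a derivation, and after
    further changes of basis the bracket is homogeneous for a grading for which omega
    is homogeneous too; hence the bracket can be multiplied by any positive constant
    by means of a symplectomorphism.

    Variation. Writing compatible metrics as pull-backs of a fixed one by
    symplectomorphisms, the bracket mu varies instead of the metric: the scalar
    curvature is -|mu|^2/4 and tr(Ric E) = <E.mu,mu>/4, where E.mu is the action on
    brackets. The dilations remove the constraint on the scalar curvature, so a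
    minimal metric minimizes |Ric^ac|^2/|mu|^4. Along the transvections
    X + s omega(X,v)v everything is polynomial in s; the vanishing of the first-order
    terms, with the fact that transvections generate sp(omega), gives
    |mu|^2 <R.mu,A.mu> = <R.mu,mu><A.mu,mu> for A in sp(omega) and R = Ric^ac. For A = R
    this is equality in Cauchy-Schwarz, so R.mu = lambda mu, that is, R + lambda is a
    derivation. *)
Require Import Defs.
From HB Require Import structures.
From mathcomp Require Import all_boot all_order all_algebra ring lra.
From mathcomp Require Import boolp classical_sets reals.

Set Implicit Arguments.
Unset Strict Implicit.
Unset Printing Implicit Defensive.

Import Order.TTheory GRing.Theory Num.Theory.
Local Open Scope ring_scope.

(** * Traces and orthonormal bases *)

Section Trace.
Variables (R : realType) (V : vectType R).
Implicit Types f h : 'End(V).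

Lemma lftrace0 : lftrace (0 : 'End(V)) = 0.
Proof.
by have := lftrace_linear (-1) (0 : 'End(V)) 0; rewrite scaler0 addr0 mulN1r addNr.
Qed.

Lemma lftrace_coord f : lftrace f =
  \sum_i coord (vbasis {:V}) i (f (vbasis {:V})`_i).
Proof.
rewrite /lftrace /mxtrace; apply: eq_bigr => i _.
by rewrite !mxE /= passmx.vecof_delta.
Qed.

(* By linearity it is enough to take the trace of the rank one maps
   X |-> phi i X *: f (e i). *)
Lemma lftrace_dual (I : finType) (phi : I -> V -> R) (e : I -> V) f :
  (forall i, linear (phi i : V -> R^o)) ->
  (forall X, X = \sum_i phi i X *: e i) ->
  lftrace f = \sum_i phi i (f (e i)).
Proof.
move=> phi_lin ephi; rewrite lftrace_coord.
have phi0 i : phi i 0 = 0.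
  by have := phi_lin i (-1) 0 0; rewrite scaler0 addr0 scaleN1r addNr.
have phi_sum i (K : finType) (a : K -> R) (v : K -> V) :
    phi i (\sum_k a k *: v k) = \sum_k a k * phi i (v k).
  have phiD : {morph phi i : x y / x + y}.
    by move=> x y; have := phi_lin i 1 x y; rewrite !scale1r.
  rewrite (big_morph _ phiD (phi0 i)); apply: eq_bigr => k _.
  by have := phi_lin i (a k) (v k) 0; rewrite phi0 !addr0.
transitivity (\sum_(j < \dim {:V}) \sum_i phi i (vbasis {:V})`_j * coord (vbasis {:V}) j (f (e i))).
  apply: eq_bigr => j _; rewrite {1}[(vbasis {:V})`_j]ephi !linear_sum /=.
  by apply: eq_bigr => i _; rewrite !linearZ.
rewrite exchange_big; apply: eq_bigr => i _ /=.
rewrite [in RHS](coord_vbasis (memvf (f (e i)))) phi_sum.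
by apply: eq_bigr => j _; rewrite mulrC.
Qed.

(** Induction on [k], with the size [n] free. For a full-rank factorization A = C D, tr A = tr (D C)
    and A^(k+1) = C (D C)^k D; cancelling [C] and [D] leaves (D C)^k = 0. *)
Lemma mxtrace_nilpotent k n (A : 'M[R]_n) :
  iter k (mulmx A) 1%:M = 0 -> \tr A = 0.
Proof.
elim: k n A => [|k IH] n A /= A0.
  by rewrite -[A]mulmx1 A0 mulmx0 linear0.
have := mulmx_base A; have := col_base_full A; have := row_base_free A.
move: (col_base A) (row_base A) => C D /row_freeP[D' DD'] /row_fullP[C' C'C] /esym defA.
rewrite {1}defA mxtrace_mulC; apply: IH.
have step m : A *m iter m (mulmx A) 1%:M = C *m iter m (mulmx (D *m C)) 1%:M *m D.
  elim: m => [|m IHm] /=; first by rewrite !mulmx1.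
  by rewrite {1}IHm {1}defA !mulmxA.
have := congr1 (fun M => C' *m M *m D') (etrans (esym (step k)) A0).
by rewrite mulmx0 mul0mx -!mulmxA DD' mulmx1 mulmxA C'C mul1mx.
Qed.

Lemma lftrace_nilpotent k f : (forall X, iter k f X = 0) -> lftrace f = 0.
Proof.
move=> fk; apply: (@mxtrace_nilpotent k).
have -> m : iter m (mulmx (passmx.mxof (vbasis {:V}) (vbasis {:V}) f)) 1%:M =
    passmx.mxof (vbasis {:V}) (vbasis {:V}) (iter m (fun h => h \o f)%VF \1%VF).
  elim: m => [|m IHm] /=; first by rewrite passmx.mxof1 // (basis_free (vbasisP _)).
  by rewrite IHm (passmx.mxof_comp _ _ (vbasisP _)).
suff -> : iter k (fun h => h \o f)%VF \1%VF = 0.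
  by apply/matrixP => i j; rewrite !mxE /= zero_lfunE linear0.
apply/lfunP => X; rewrite zero_lfunE -[RHS](fk X).
elim: k X {fk} => [|k IHk] X /=; first by rewrite id_lfunE.
by rewrite comp_lfunE IHk -iterS iterSr.
Qed.

End Trace.

Section OrthonormalBasis.
Variables (R : realType) (V : vectType R) (g : {dot V for idfun}).
Implicit Types X Y : V.

Lemma dotC X Y : g X Y = g Y X.
Proof. by rewrite (hermitian_subproof (s := g)) expr0 mul1r. Qed.

Lemma dot_eq0 X : g X X = 0 -> X = 0.
Proof. by move=> gX; apply/eqP; apply: contra_eqT gX => /(neq0_dnorm_gt0 (s := g)) /gt_eqF ->. Qed.

Lemma dot_inj X Y : (forall Z, g X Z = g Y Z) -> X = Y.
Proof.
by move=> XY; apply/eqP; rewrite -subr_eq0; apply/eqP/dot_eq0; rewrite linearBl /= XY subrr.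
Qed.

Definition orthonormal_basis n (e : 'I_n -> V) : Prop :=
  (forall i j, g (e i) (e j) = (i == j)%:R) /\
  (forall X, X = \sum_i g X (e i) *: e i).

(** Gram-Schmidt, on families indexed by [nat] so that appending a vector does not change the index
    type. *)
Lemma orthonormal_basis_exists :
  exists e : 'I_(\dim {:V}) -> V, orthonormal_basis e.
Proof.
have [e eON] : exists e : nat -> V, forall i j, (i < \dim {:V})%N ->
    (j < \dim {:V})%N -> g (e i) (e j) = (i == j)%:R.
  suff : forall k, (k <= \dim {:V})%N -> exists e : nat -> V,
    forall i j, (i < k)%N -> (j < k)%N -> g (e i) (e j) = (i == j)%:R by apply.
  elim=> [|k IH] kV; first by exists (fun=> 0).
  have [e eON] := IH (ltnW kV).
  have /subvPn[X _ XnU] : ~~ ({:V} <= <<mkseq e k>>)%VS.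
    apply/negP => /dimvS; rewrite leqNgt; apply/negP; rewrite negbK.
    by apply: leq_ltn_trans (dim_span _) _; rewrite size_mkseq.
  pose Y := X - \sum_(i < k) g X (e i) *: e i.
  have Y0 : Y != 0.
    apply: contraNneq XnU => /eqP; rewrite subr_eq0 => /eqP ->.
    apply: rpred_sum => i _; apply/rpredZ/memv_span.
    by apply: map_f; rewrite mem_iota add0n /=.
  have gY j : (j < k)%N -> g Y (e j) = 0.
    move=> jk; rewrite /Y linearBl /= linear_sumlz (bigD1 (Ordinal jk)) //=.
    rewrite linearZl_LR /= eON // eqxx mulr1 big1 ?addr0 ?subrr // => i /negPf ij.
    by rewrite linearZl_LR /= eON // -(inj_eq val_inj) /= in ij *; rewrite ij mulr0.
  have gYY : 0 < g Y Y by exact: neq0_dnorm_gt0.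
  pose Z := (Num.sqrt (g Y Y))^-1 *: Y.
  have gZ j : (j < k)%N -> g Z (e j) = 0.
    by move=> jk; rewrite linearZl_LR /= gY // mulr0.
  have gZZ : g Z Z = 1.
    rewrite linearZl_LR linearZr_LR /= mulrA -invfM -expr2 sqr_sqrtr ?ltW //.
    by rewrite mulVf ?gt_eqF.
  exists (fun i => if i == k then Z else e i) => i j.
  rewrite !ltnS => ik jk.
  have [->|ni] := eqVneq i k; have [jk0|nj] := eqVneq j k => //.
  - by rewrite gZ // ltn_neqAle nj.
  - by rewrite jk0 dotC gZ ?(negPf ni) // ltn_neqAle ni.
  - by apply: eON; rewrite ltn_neqAle ?ni ?nj.
exists (fun i => e i); split=> [i j|X]; first by rewrite eON.
set n := \dim {:V} in eON *; have [t tE] : exists t : n.-tuple V, forall i : 'I_n, t`_i = e i.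
  by exists [tuple e i | i < n] => i; rewrite -tnth_nth tnth_mktuple.
have t_coef (c : 'I_n -> R) (i : 'I_n) : g (\sum_j c j *: t`_j) (e i) = c i.
  rewrite linear_sumlz (bigD1 i) //= linearZl_LR /= tE eON // eqxx mulr1.
  rewrite big1 ?addr0 // => j ji; rewrite linearZl_LR /= tE.
  by rewrite eON // (inj_eq val_inj) (negPf ji) mulr0.
have bas : basis_of {:V} t.
  rewrite basisEfree subvf size_tuple leqnn !andbT; apply/freeP => c c0 i.
  by rewrite -t_coef c0 linear0l.
rewrite {1}(coord_basis bas (memvf X)); apply: eq_bigr => i _.
by rewrite tE {2}(coord_basis bas (memvf X)) t_coef.
Qed.

Lemma lftrace_orthonormal n (e : 'I_n -> V) (f : 'End(V)) :
  orthonormal_basis e -> lftrace f = \sum_i g (f (e i)) (e i).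
Proof.
move=> [_ eX]; rewrite (lftrace_dual (phi := fun i X => g X (e i)) f _ eX) //.
by move=> i c X Y; rewrite linearPl.
Qed.
End OrthonormalBasis.

(** * The Ricci form of a nilpotent metric Lie algebra *)

Section Parseval.
Variables (R : realType) (V : vectType R) (g : {dot V for idfun}).
Variables (n : nat) (e : 'I_n -> V).
Hypothesis eON : orthonormal_basis g e.

Lemma parseval X Y : g X Y = \sum_i g X (e i) * g Y (e i).
Proof.
rewrite {1}[Y](eON.2) linear_sumr; apply: eq_bigr => i _.
by rewrite linearZr_LR /= mulrC.
Qed.

Lemma parseval_lin (f : V -> V) X Z : linear f ->
  g (f X) Z = \sum_i g X (e i) * g (f (e i)) Z.
Proof.
move=> f_lin; have [fD fZ] : {morph f : x y / x + y} /\ scalable f.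
  split=> [x y|a x]; first by have := f_lin 1 x y; rewrite !scale1r.
  have f0 : f 0 = 0 by have := f_lin (-1) 0 0; rewrite scaler0 addr0 scaleN1r addNr.
  by have := f_lin a x 0; rewrite f0 !addr0.
have f0 : f 0 = 0 by have := fZ 0 0; rewrite !scale0r.
rewrite {1}[X](eON.2) (big_morph _ fD f0) linear_sumlz; apply: eq_bigr => i _.
by rewrite fZ linearZl_LR.
Qed.
End Parseval.

Section Ricci.
Variables (R : realType) (V : vectType R) (br : {bilinear V -> V -> V}).
Variables (g : {dot V for idfun}) (n : nat) (e : 'I_n -> V).
Hypothesis lie : lie_bracket br.
Hypothesis eON : orthonormal_basis g e.
Hypothesis unimodular : forall X, lftrace (ad br X) = 0.
Hypothesis killing0 : forall X Y, lftrace (ad br X \o ad br Y)%VF = 0.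
Implicit Types X Y Z : V.

Let brC X Y : br Y X = - br X Y. Proof. exact: bracketC. Qed.

(** Skew-adjointness of [nabla Y] turns the second term into an inner product of two covariant
    derivatives, so the Ricci trace can be computed from Koszul forms. *)
Lemma curvatureE X Y Z W : g (curvature br g X Y Z) W =
  koszul br g X (nabla br g Y Z) W + koszul br g Y W (nabla br g X Z)
  - koszul br g (br X Y) Z W.
Proof.
have skew A B C : g (nabla br g A B) C = - g (nabla br g A C) B.
  by apply/eqP; rewrite -addr_eq0 [X in _ + X]dotC nabla_metric.
rewrite /curvature !(add_lfunE, opp_lfunE, comp_lfunE) !linearBl /=.
by rewrite (skew Y) -!nablaE opprK.
Qed.

Let trace_ad X : \sum_i g (br X (e i)) (e i) = 0.
Proof.
rewrite -[RHS](unimodular X) (lftrace_orthonormal _ eON).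
by apply: eq_bigr => i _; rewrite adE.
Qed.

Let trace_adad X Y : \sum_i g (br X (br Y (e i))) (e i) = 0.
Proof.
rewrite -[RHS](killing0 X Y) (lftrace_orthonormal _ eON).
by apply: eq_bigr => i _; rewrite comp_lfunE !adE.
Qed.

Let sum_antisym (F : 'I_n -> 'I_n -> R) :
  (forall i j, F i j = - F j i) -> \sum_i \sum_j F i j = 0.
Proof.
move=> F_anti; have : \sum_i \sum_j F i j = - \sum_i \sum_j F i j.
  rewrite {1}exchange_big -sumrN; apply: eq_bigr => i _ /=.
  by rewrite -sumrN; apply: eq_bigr => j _.
by lra.
Qed.

(** The general Ricci formula also contains traces of [ad] and the Killing form, which [unimodular]
    and [killing0] remove. *)
Lemma ricci_form_nilpotent Y Z : ricci_form br g Y Z =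
  - 2^-1 * (\sum_i g (br Z (e i)) (br Y (e i)))
  + 4^-1 * (\sum_i \sum_j g (br (e i) (e j)) Z * g (br (e i) (e j)) Y).
Proof.
rewrite /ricci_form (lftrace_orthonormal _ eON).
pose L : {linear V -> V} := HB.pack (fun X => curvature br g X Y Z)
    (GRing.isLinear.Build R V V _ _ (@curvature_linear _ _ br g Y Z)).
under eq_bigr => i _ do rewrite (lfunE L) /= curvatureE.
rewrite !big_split /= sumrN.
have -> : \sum_i koszul br g (e i) (nabla br g Y Z) (e i) = 0.
  rewrite -[RHS]oppr0 -[in RHS](trace_ad (nabla br g Y Z)) -sumrN.
  apply: eq_bigr => i _; rewrite /koszul (brC (nabla br g Y Z)) (lie.1) linear0l.
  by rewrite linearNl /=; field.
pose a i j := g (br Z (e i)) (e j); pose d i j := g (br Y (e i)) (e j).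
pose z i j := g (br (e i) (e j)) Z; pose y i j := g (br (e i) (e j)) Y.
have -> : \sum_i koszul br g Y (e i) (nabla br g (e i) Z) =
    \sum_i \sum_j 4^-1 * ((- a i j - a j i - z i j) * (d i j - d j i - y i j)).
  apply: eq_bigr => i _.
  have -> : koszul br g Y (e i) (nabla br g (e i) Z) =
      g (nabla br g Y (e i)) (nabla br g (e i) Z) by rewrite nablaE.
  rewrite (parseval eON); apply: eq_bigr => j _.
  rewrite -!nablaE /koszul (brC Z (e i)) (brC (e i) (e j)) (brC Y (e j)).
  rewrite !linearNl /= -/(a i j) -/(a j i) -/(d i j) -/(d j i) -/(z i j) -/(y i j).
  by field.
have -> : \sum_i koszul br g (br (e i) Y) Z (e i) =
    \sum_i \sum_j 2^-1 * (a i j * d i j - d i j * z i j).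
  transitivity (\sum_i 2^-1 * (g (br Z (br Y (e i))) (e i)
      + (\sum_j (a i j * d i j - d i j * z i j)))); last first.
    rewrite -mulr_sumr big_split /= trace_adad add0r mulr_sumr.
    by apply: eq_bigr => i _; rewrite mulr_sumr.
  apply: eq_bigr => i _; rewrite /koszul; congr (_ * _); rewrite -addrA; congr (_ + _).
    by rewrite (brC Z) (brC Y) linearNr opprK.
  rewrite sumrB; congr (_ + _).
    by rewrite (brC Y) linearNr /= opprK (parseval eON).
  rewrite (brC Y) linearNr linearNl /=.
  rewrite (parseval_lin eON (f := br (e i))); last by move=> c A B; rewrite linearPr.
  by [].
rewrite add0r.
(* The first sum on the right is antisymmetric under exchange of i and j, as [y] and [z] are; only
   the second contributes. *)
have -> : \sum_i \sum_j 4^-1 * ((- a i j - a j i - z i j) * (d i j - d j i - y i j))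
    - \sum_i \sum_j 2^-1 * (a i j * d i j - d i j * z i j) =
    \sum_i \sum_j 4^-1 * (- (a i j + a j i) * (d i j - d j i - y i j)
                          + z i j * (d i j + d j i))
    + \sum_i \sum_j (4^-1 * (z i j * y i j) - 2^-1 * (a i j * d i j)).
  rewrite -sumrB -big_split /=; apply: eq_bigr => i _.
  rewrite -sumrB -big_split /=; apply: eq_bigr => j _.
  by field.
rewrite sum_antisym => [|i j]; last first.
  have -> : y i j = - y j i by rewrite /y brC linearNl.
  have -> : z i j = - z j i by rewrite /z brC linearNl.
  by field.
rewrite !add0r addrC mulr_sumr mulr_sumr -big_split /=; apply: eq_bigr => i _.
rewrite (parseval eON) !mulr_sumr -big_split /=; apply: eq_bigr => j _.
by rewrite -/(a i j) -/(d i j) -/(z i j) -/(y i j); ring.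
Qed.

End Ricci.

Section Nilpotent.
Variables (R : realType) (V : vectType R) (br : {bilinear V -> V -> V}).
Hypothesis nil3 : lower_central br 3 = 0%VS.

Lemma bracket4_eq0 X Y Z W : br X (br Y (br Z W)) = 0.
Proof.
apply/eqP; rewrite -memv0 -nil3.
by rewrite /lower_central /=; do 3!(apply: mem_br_space; first exact: memvf); exact: memvf.
Qed.

Lemma unimodular_nilpotent X : lftrace (ad br X) = 0.
Proof. by apply: (@lftrace_nilpotent _ _ 3) => Y /=; rewrite !adE bracket4_eq0. Qed.

Lemma killing_nilpotent X Y : lftrace (ad br X \o ad br Y)%VF = 0.
Proof.
by apply: (@lftrace_nilpotent _ _ 2) => Z /=; rewrite !comp_lfunE !adE bracket4_eq0.
Qed.
End Nilpotent.

(** * Brackets and Ricci operators in coordinates *)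

Section Jet.
Variable R : realType.
Implicit Types (f h : R -> R) (a b s : R).

(** Value and derivative at 0 of a polynomial function. With a polynomial remainder, differentiation
    is pure algebra and the remainder is bounded on [-1, 1]. *)
Definition jet f a b : Prop :=
  exists q : {poly R}, forall s, f s = a + b * s + s ^+ 2 * q.[s].

Lemma eq_jet f h a b : f =1 h -> jet f a b -> jet h a b.
Proof. by move=> fh [q fq]; exists q => s; rewrite -fh. Qed.

Lemma jet_const a : jet (fun=> a) a 0.
Proof. by exists 0 => s; rewrite horner0 mul0r mulr0 !addr0. Qed.

Lemma jetD f h a b a' b' :
  jet f a b -> jet h a' b' -> jet (fun s => f s + h s) (a + a') (b + b').
Proof. by move=> [p fp] [q hq]; exists (p + q) => s; rewrite fp hq hornerD; ring. Qed.

Lemma jetM f h a b a' b' :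
  jet f a b -> jet h a' b' -> jet (fun s => f s * h s) (a * a') (a * b' + b * a').
Proof.
move=> [p fp] [q hq].
exists ((b * b')%:P + (a%:P + b *: 'X) * q + (a'%:P + b' *: 'X) * p + 'X^2 * p * q) => s.
rewrite fp hq !hornerE; ring.
Qed.

Lemma jetZ c f a b : jet f a b -> jet (fun s => c * f s) (c * a) (c * b).
Proof.
by move=> [p fp]; exists (c *: p) => s; rewrite fp hornerZ; ring.
Qed.

Lemma jet_sum (I : finType) (f : I -> R -> R) (a b : I -> R) :
  (forall i, jet (f i) (a i) (b i)) ->
  jet (fun s => \sum_i f i s) (\sum_i a i) (\sum_i b i).
Proof.
move=> fab; rewrite unlock /reducebig.
elim: (index_enum I) => [|i r IH] /=; first exact: jet_const.
exact: jetD.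
Qed.

Lemma jet_sum0 (I : finType) (f : I -> R -> R) :
  (forall i, jet (f i) 0 0) -> jet (fun s => \sum_i f i s) 0 0.
Proof. by move=> f0; have := jet_sum f0; rewrite big1. Qed.

Lemma horner_bounded (q : {poly R}) :
  exists2 C, 0 <= C & forall s, `|s| <= 1 -> `|q.[s]| <= C.
Proof.
exists (\sum_(i < size q) `|q`_i|) => [|s s1]; first exact: sumr_ge0.
rewrite horner_coef (le_trans (ler_norm_sum _ _ _)) // ler_sum // => i _.
by rewrite normrM normrX ler_piMr // exprn_ile1.
Qed.

Lemma jet_ge0 f b : jet f 0 b -> (forall s, 0 <= f s) -> b = 0.
Proof.
move=> [q fq] f0; have [C C0 qC] := horner_bounded q.
apply/eqP; rewrite eq_le -!(rwP andP); have [->//|b0] := eqVneq b 0.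
(* This [D] gives |s| <= 1 and C / D < 1 for s = - b / D, so the linear term - b^2 / D outweighs the
   remainder and [f s] would be negative. *)
pose D := `|b| + C + 1; have b_gt0 : 0 < `|b| by rewrite normr_gt0.
have D0 : 0 < D by rewrite /D; lra.
pose s := - b / D; have s1 : `|s| <= 1.
  rewrite /s normrM normrN normfV (gtr0_norm D0) ler_pdivrMr // mul1r /D; lra.
have := f0 s; rewrite fq add0r => fs.
have : s ^+ 2 * q.[s] <= s ^+ 2 * C.
  by apply: ler_wpM2l; [exact: sqr_ge0|apply: le_trans (ler_norm _) (qC _ s1)].
have -> : s ^+ 2 * C = b ^+ 2 / D * (C / D) by rewrite /s; field; rewrite gt_eqF.
have bs : b * s = - (b ^+ 2 / D) by rewrite /s; ring.
have CD : C / D < 1 by rewrite ltr_pdivrMr // mul1r /D; lra.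
have bD : 0 < b ^+ 2 / D by rewrite divr_gt0 // exprn_even_gt0.
have : b ^+ 2 / D * (C / D) < b ^+ 2 / D by rewrite -[ltRHS]mulr1 ltr_pM2l.
move: fs; rewrite bs; lra.
Qed.

End Jet.

Section Bracket.
Variables (R : realType) (n : nat).
Implicit Types (c d : 'I_n -> 'I_n -> 'I_n -> R) (E M J S : 'M[R]_n).

(* c i j k stands for the coordinate g([e_i,e_j], e_k) in an orthonormal basis. *)
Definition skew3 c := forall i j k, c j i k = - c i j k.

Definition dot3 c d := \sum_i \sum_j \sum_k c i j k * d i j k.

(** The formula of [ricci_form_nilpotent] for arbitrary structure constants, since the variation
    moves the bracket. *)
Definition ricmx c : 'M[R]_n := \matrix_(k, l)
  (- 2^-1 * (\sum_i \sum_j c k i j * c l i j)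
   + 4^-1 * (\sum_i \sum_j c i j k * c i j l)).

Definition acmx J M : 'M[R]_n := 2^-1 *: (M + J *m M *m J).

(* The action E [X,Y] - [E X,Y] - [X,E Y] of an endomorphism on the bracket, where
   the rows of E are the coordinates of the images of the basis vectors. *)
Definition act3 E c i j k :=
  \sum_l (c i j l * E l k - E i l * c l j k - E j l * c i l k).

Lemma dot3C c d : dot3 c d = dot3 d c.
Proof. by do 3![apply: eq_bigr => ? _]; rewrite mulrC. Qed.

Lemma dot3_ge0 c : 0 <= dot3 c c.
Proof. by do 3![apply: sumr_ge0 => ? _]; rewrite -expr2 sqr_ge0. Qed.

Lemma dot3_eq0 c : dot3 c c = 0 -> forall i j k, c i j k = 0.
Proof.
move=> /eqP c0 i j k; apply/eqP; rewrite -sqrf_eq0 expr2; move: c0.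
rewrite psumr_eq0 => [|? _]; last by do 2![apply: sumr_ge0 => ? _]; rewrite -expr2 sqr_ge0.
move=> /allP /(_ i); rewrite mem_index_enum => /(_ isT).
rewrite psumr_eq0 => [|? _]; last by apply: sumr_ge0 => ? _; rewrite -expr2 sqr_ge0.
move=> /allP /(_ j); rewrite mem_index_enum => /(_ isT).
rewrite psumr_eq0 => [|? _]; last by rewrite -expr2 sqr_ge0.
by move=> /allP /(_ k); rewrite mem_index_enum => /(_ isT).
Qed.

Lemma dot3D c d d' : dot3 c (fun i j k => d i j k + d' i j k) = dot3 c d + dot3 c d'.
Proof. by rewrite /dot3; do 3![rewrite -big_split /=; apply: eq_bigr => ? _]; rewrite mulrDr. Qed.

Lemma dot3Z c d a : dot3 c (fun i j k => a * d i j k) = a * dot3 c d.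
Proof.
rewrite /dot3; do 3![rewrite mulr_sumr; apply: eq_bigr => ? _].
by rewrite mulrCA.
Qed.

Lemma eq_dot3 c c' d d' : (forall i j k, c i j k = c' i j k) ->
  (forall i j k, d i j k = d' i j k) -> dot3 c d = dot3 c' d'.
Proof. by move=> cc dd; do 3![apply: eq_bigr => ? _]; rewrite cc dd. Qed.

Lemma act3D E E' c i j k : act3 (E + E') c i j k = act3 E c i j k + act3 E' c i j k.
Proof. by rewrite /act3 -big_split /=; apply: eq_bigr => l _; rewrite !mxE; ring. Qed.

Lemma act3Z a E c i j k : act3 (a *: E) c i j k = a * act3 E c i j k.
Proof. by rewrite /act3 mulr_sumr; apply: eq_bigr => l _; rewrite !mxE; ring. Qed.

Lemma act3_skew E c : skew3 c -> skew3 (act3 E c).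
Proof.
move=> cs i j k; rewrite /act3 -sumrN; apply: eq_bigr => l _.
by rewrite (cs i j) (cs i l) (cs l j); ring.
Qed.

(* Each of the three slots of c contributes one sum; the two lower slots give
   the same by skew-symmetry. *)
Lemma dot3_act3 E c d : skew3 c -> skew3 d -> dot3 (act3 E c) d =
  \sum_i \sum_j \sum_k \sum_l c i j l * E l k * d i j k
  - 2 * \sum_i \sum_j \sum_k \sum_l E i l * c l j k * d i j k.
Proof.
move=> cs ds.
have -> : dot3 (act3 E c) d =
    \sum_i \sum_j \sum_k \sum_l c i j l * E l k * d i j k
    - \sum_i \sum_j \sum_k \sum_l E i l * c l j k * d i j k
    - \sum_i \sum_j \sum_k \sum_l E j l * c i l k * d i j k.
  rewrite /dot3 -!sumrB; apply: eq_bigr => i _; rewrite -!sumrB.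
  apply: eq_bigr => j _; rewrite -!sumrB; apply: eq_bigr => k _.
  by rewrite -!sumrB /act3 mulr_suml; apply: eq_bigr => l _; ring.
have -> : \sum_i \sum_j \sum_k \sum_l E j l * c i l k * d i j k =
    \sum_i \sum_j \sum_k \sum_l E i l * c l j k * d i j k.
  rewrite exchange_big /=; apply: eq_bigr => i _; apply: eq_bigr => j _.
  by apply: eq_bigr => k _; apply: eq_bigr => l _; rewrite (cs l j) (ds i j); ring.
by ring.
Qed.

Lemma act3_selfadjoint E c d : skew3 c -> skew3 d -> E^T = E ->
  dot3 (act3 E c) d = dot3 c (act3 E d).
Proof.
move=> cs ds ET; have Esym i l : E i l = E l i by rewrite -[in LHS]ET mxE.
rewrite (dot3C c) !dot3_act3 //; congr (_ - _ * _).
  apply: eq_bigr => i _; apply: eq_bigr => j _; rewrite exchange_big /=.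
  by apply: eq_bigr => k _; apply: eq_bigr => l _; rewrite (Esym k); ring.
(* Here [E] links [i] and [l]: the sum over [l] is moved outwards past [k] and [j] before it is
   exchanged with the sum over [i]. *)
under eq_bigr => i _ do under eq_bigr => j _ do rewrite exchange_big /=.
under eq_bigr => i _ do rewrite exchange_big /=.
under [RHS]eq_bigr => i _ do under eq_bigr => j _ do rewrite exchange_big /=.
under [RHS]eq_bigr => i _ do rewrite exchange_big /=.
rewrite exchange_big /=; apply: eq_bigr => i _; apply: eq_bigr => j _.
by apply: eq_bigr => k _; apply: eq_bigr => l _; rewrite (Esym j); ring.
Qed.

(* The Ricci operator is the moment map of the action on brackets. *)
Lemma mxtrace_ricmx E c : skew3 c -> \tr (ricmx c *m E) = 4^-1 * dot3 (act3 E c) c.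
Proof.
move=> cs; rewrite dot3_act3 //.
have -> : \tr (ricmx c *m E) =
    4^-1 * (\sum_k \sum_l \sum_i \sum_j c i j l * E l k * c i j k)
    - 2^-1 * (\sum_k \sum_l \sum_i \sum_j E l k * c k i j * c l i j).
  rewrite /mxtrace !mulr_sumr -sumrB; apply: eq_bigr => k _.
  rewrite mxE !mulr_sumr -sumrB; apply: eq_bigr => l _.
  rewrite mxE mulrDl addrC; congr (_ + _).
    rewrite -mulrA mulr_suml; congr (_ * _); apply: eq_bigr => i _.
    by rewrite mulr_suml; apply: eq_bigr => j _; ring.
  rewrite mulNr mulNr; congr (- _); rewrite -mulrA mulr_suml; congr (_ * _).
  apply: eq_bigr => i _; rewrite mulr_suml; apply: eq_bigr => j _; ring.
have -> : \sum_k \sum_l \sum_i \sum_j c i j l * E l k * c i j k =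
    \sum_i \sum_j \sum_k \sum_l c i j l * E l k * c i j k.
  under eq_bigr => k _ do rewrite exchange_big /=.
  under eq_bigr => k _ do under eq_bigr => i _ do rewrite exchange_big /=.
  rewrite exchange_big /=; apply: eq_bigr => i _; exact: exchange_big.
have -> : \sum_k \sum_l \sum_i \sum_j E l k * c k i j * c l i j =
    \sum_i \sum_j \sum_k \sum_l E i l * c l j k * c i j k.
  rewrite exchange_big /=; apply: eq_bigr => i _; rewrite exchange_big /=.
  apply: eq_bigr => j _; exact: exchange_big.
by field.
Qed.

Lemma ricmx_sym c : (ricmx c)^T = ricmx c.
Proof.
apply/matrixP => k l; rewrite !mxE; congr (_ * _ + _ * _).
  by do 2![apply: eq_bigr => ? _]; rewrite mulrC.
by do 2![apply: eq_bigr => ? _]; rewrite mulrC.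
Qed.

Section Complex.
Variable J : 'M[R]_n.
Hypotheses (JT : J^T = - J) (JJ : J *m J = - 1%:M).

Lemma acmx_conj M : J *m acmx J M *m J = acmx J M.
Proof.
rewrite /acmx -scalemxAr -scalemxAl mulmxDr mulmxDl; congr (_ *: _).
by rewrite !mulmxA JJ -!mulmxA JJ !mulmxN mulmx1 !mulNmx mul1mx opprK addrC.
Qed.

Lemma acmx_sym M : M^T = M -> (acmx J M)^T = acmx J M.
Proof.
move=> MT; rewrite /acmx linearZ linearD /= !trmx_mul MT JT.
by rewrite !(mulNmx, mulmxN) opprK mulmxA.
Qed.

(** For the trace form, [acmx J] is the orthogonal projection onto the matrices with J E J = E. *)
Lemma mxtrace_acmx M E : J *m E *m J = E -> \tr (acmx J M *m E) = \tr (M *m E).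
Proof.
move=> JE; rewrite /acmx -scalemxAl mulmxDl mxtraceZ mxtraceD.
have -> : \tr (J *m M *m J *m E) = \tr (M *m E).
  by rewrite -!mulmxA mxtrace_mulC -!mulmxA (mulmxA J) JE.
by field.
Qed.


Let ac c := acmx J (ricmx c).

Let ac_sym c : (ac c)^T = ac c. Proof. exact/acmx_sym/ricmx_sym. Qed.

Let mxtrace_ac c E : skew3 c -> J *m E *m J = E ->
  \tr (ac c *m E) = 4^-1 * dot3 (act3 E c) c.
Proof. by move=> cs JE; rewrite mxtrace_acmx ?mxtrace_ricmx. Qed.

(** The first-order coefficient may stay anonymous: [critical_direction] uses these expansions only
    in products of two differences that vanish at 0. *)
Lemma jet_acmx (c : R -> 'I_n -> 'I_n -> 'I_n -> R) c0 d :
  (forall i j k, jet (fun s => c s i j k) (c0 i j k) (d i j k)) ->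
  forall k l, exists b, jet (fun s => ac (c s) k l) (ac c0 k l) b.
Proof.
move=> cj.
have ric_jet k l : exists b, jet (fun s => ricmx (c s) k l) (ricmx c0 k l) b.
  eexists; apply: (@eq_jet _ (fun s => - 2^-1 * (\sum_i \sum_j c s k i j * c s l i j)
     + 4^-1 * (\sum_i \sum_j c s i j k * c s i j l))) => [s|]; first by rewrite mxE.
  rewrite mxE; apply: jetD; apply: jetZ; apply: jet_sum => i; apply: jet_sum => j;
    exact: jetM.
have /choice[b bj] (p : 'I_n * 'I_n) := ric_jet p.1 p.2.
have E c' k l : ac c' k l = 2^-1 * (ricmx c' k l
    + \sum_a \sum_b J k b * (J a l * ricmx c' b a)).
  rewrite /ac /acmx !mxE; congr (_ * (_ + _)); apply: eq_bigr => a _.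
  by rewrite mxE mulr_suml; apply: eq_bigr => b' _; ring.
move=> k l; eexists; apply: (@eq_jet _ (fun s => 2^-1 * (ricmx (c s) k l
    + \sum_a \sum_b J k b * (J a l * ricmx (c s) b a)))) => [s|]; first by rewrite E.
rewrite E; apply: jetZ; apply: jetD; first exact: (bj (k, l)).
apply: jet_sum => a; apply: jet_sum => b'.
by do 2![apply: jetZ]; exact: (bj (_, _)).
Qed.

Lemma jet_dot3 (c c' : R -> 'I_n -> 'I_n -> 'I_n -> R) c0 c0' d d' :
  (forall i j k, jet (fun s => c s i j k) (c0 i j k) (d i j k)) ->
  (forall i j k, jet (fun s => c' s i j k) (c0' i j k) (d' i j k)) ->
  jet (fun s => dot3 (c s) (c' s)) (dot3 c0 c0') (dot3 c0 d' + dot3 d c0').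
Proof.
move=> cj cj'; have -> : dot3 c0 d' + dot3 d c0' = \sum_i \sum_j \sum_k
    (c0 i j k * d' i j k + d i j k * c0' i j k).
  by rewrite /dot3 -big_split; do 2![apply: eq_bigr => ? _; rewrite -big_split].
by do 3![apply: jet_sum => ?]; apply: jetM.
Qed.

(* The squared norm of ac (c s) splits as |ac c0|^2 + 2 <ac c0, ac (c s) - ac c0>
   + |ac (c s) - ac c0|^2, and the last term is of second order. *)
Lemma critical_direction (c : R -> 'I_n -> 'I_n -> 'I_n -> R) c0 d :
  (forall i j k, jet (fun s => c s i j k) (c0 i j k) (d i j k)) ->
  (forall s, skew3 (c s)) -> skew3 c0 -> skew3 d -> dot3 c0 c0 != 0 ->
  (forall s, \tr (ac c0 *m ac c0) * dot3 (c s) (c s) ^+ 2 <=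
             \tr (ac (c s) *m ac (c s)) * dot3 c0 c0 ^+ 2) ->
  dot3 (act3 (ac c0) c0) d * dot3 c0 c0 = dot3 (act3 (ac c0) c0) c0 * dot3 d c0.
Proof.
move=> cj css c0s ds c00 min; set E := ac c0; set a := dot3 c0 c0.
have JE : J *m E *m J = E by exact: acmx_conj.
have tr_jet : jet (fun s => \tr (ac (c s) *m ac (c s))) (\tr (E *m E)) (dot3 (act3 E c0) d).
  (* Since J E J = E, the cross term with [E] is the quadratic expression <E.c, c> / 4, which
     carries the whole first-order part. *)
  have E1 s : \tr (ac (c s) *m ac (c s)) = 2^-1 * dot3 (act3 E (c s)) (c s)
      + - \tr (E *m E) + \tr ((ac (c s) - E) *m (ac (c s) - E)).
    rewrite mulmxBl !mulmxBr !linearB /= (mxtrace_mulC E (ac (c s))).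
    by rewrite (mxtrace_ac (css s) JE); field.
  have act_jet : forall i j k, jet (fun s => act3 E (c s) i j k) (act3 E c0 i j k) (act3 E d i j k).
    move=> i j k; apply: (@eq_jet _ (fun s => \sum_l (E l k * c s i j l
       + (- E i l * c s l j k + - E j l * c s i l k)))) => [s|].
      by apply: eq_bigr => l _; ring.
    have F c' : act3 E c' i j k = \sum_l (E l k * c' i j l
       + (- E i l * c' l j k + - E j l * c' i l k)).
      by apply: eq_bigr => l _; ring.
    rewrite !F; apply: jet_sum => l; do 2![apply: jetD; first exact: jetZ]; exact: jetZ.
  have sq_jet : jet (fun s => \tr ((ac (c s) - E) *m (ac (c s) - E))) 0 0.
    apply: (@eq_jet _ (fun s => \sum_k \sum_l (ac (c s) k l - E k l) * (ac (c s) l k - E l k))).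
      by move=> s; apply: eq_bigr => k _; rewrite mxE; apply: eq_bigr => l _; rewrite !mxE.
    apply: jet_sum0 => k; apply: jet_sum0 => l.
    have [b bj] := jet_acmx cj k l; have [b' bj'] := jet_acmx cj l k.
    have := jetM (jetD bj (jet_const (- E k l))) (jetD bj' (jet_const (- E l k))).
    by rewrite /E !subrr !mul0r mulr0 addr0.
  apply: eq_jet (fun s => esym (E1 s)) _.
  have := jetD (jetD (jetZ 2^-1 (jet_dot3 act_jet cj)) (jet_const (- \tr (E *m E)))) sq_jet.
  have -> : 2^-1 * dot3 (act3 E c0) c0 + - \tr (E *m E) + 0 = \tr (E *m E).
    by rewrite (mxtrace_ac c0s JE); field.
  have -> // : 2^-1 * (dot3 (act3 E c0) d + dot3 (act3 E d) c0) + 0 + 0 = dot3 (act3 E c0) d.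
  by rewrite (act3_selfadjoint ds) ?ac_sym // (dot3C d); field.
(* By [min] the function a^2 tr (ac (c s))^2 - tr (E^2) |c s|^4 is nonnegative; it vanishes at s =
   0, so [jet_ge0] makes its derivative zero. *)
have := jetD (jetZ (a ^+ 2) tr_jet)
  (jetZ (- \tr (E *m E)) (jetM (jet_dot3 cj cj) (jet_dot3 cj cj))).
have -> : a ^+ 2 * \tr (E *m E) + - \tr (E *m E) * (dot3 c0 c0 * dot3 c0 c0) = 0.
  by rewrite -/a; ring.
move=> /jet_ge0 /(_ _) f'0.
have : a ^+ 2 * dot3 (act3 E c0) d + - \tr (E *m E) *
    (dot3 c0 c0 * (dot3 c0 d + dot3 d c0) + (dot3 c0 d + dot3 d c0) * dot3 c0 c0) = 0.
  apply: f'0 => s; have := min s; rewrite -/E -/a expr2; lra.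
rewrite -/a (mxtrace_ac c0s JE) (dot3C c0 d) => H.
have a0 : a != 0 by [].
apply: (mulfI a0); apply/eqP; rewrite -subr_eq0 -[X in _ == X]H; apply/eqP; by field.
Qed.

(* The matrices J *m (v^T *m v) span the Lie algebra of the symplectic group. *)
Lemma act3_eigen c0 : skew3 c0 -> dot3 c0 c0 != 0 ->
  (forall v : 'rV[R]_n, let d := act3 (J *m (v^T *m v)) c0 in
    dot3 (act3 (ac c0) c0) d * dot3 c0 c0 = dot3 (act3 (ac c0) c0) c0 * dot3 d c0) ->
  exists lambda, forall i j k, act3 (ac c0) c0 i j k = lambda * c0 i j k.
Proof.
move=> c0s c00 crit; set E := ac c0 in crit *; set a := dot3 c0 c0 in c00 crit *.
set r := act3 E c0 in crit *.
(* A linear functional, shown below to vanish on J S for symmetric S. At [E] it is the defect in the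
   Cauchy-Schwarz inequality for [r] and [c0]. *)
pose ell N := dot3 r (act3 N c0) * a - dot3 r c0 * dot3 c0 (act3 N c0).
have ellD N N' : ell (N + N') = ell N + ell N'.
  have F : forall i j k, act3 (N + N') c0 i j k = act3 N c0 i j k + act3 N' c0 i j k.
    by move=> *; rewrite act3D.
  by rewrite /ell (eq_dot3 (fun _ _ _ => erefl) F) (eq_dot3 (fun _ _ _ => erefl) F) !dot3D; ring.
have ellZ b N : ell (b *: N) = b * ell N.
  have F : forall i j k, act3 (b *: N) c0 i j k = b * act3 N c0 i j k.
    by move=> *; rewrite act3Z.
  by rewrite /ell (eq_dot3 (fun _ _ _ => erefl) F) (eq_dot3 (fun _ _ _ => erefl) F) !dot3Z; ring.
have ell0 : ell 0 = 0 by rewrite -(scale0r 0) ellZ mul0r.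
have ell_sq (v : 'rV[R]_n) : ell (J *m (v^T *m v)) = 0.
  by have := crit v; rewrite /ell /= (dot3C c0) => ->; rewrite subrr.
have ell_polar (v w : 'rV[R]_n) : ell (J *m (v^T *m w + w^T *m v)) = 0.
  have := ell_sq (v + w); rewrite [(v + w)^T]linearD /= mulmxDl !mulmxDr !ellD !ell_sq.
  by rewrite add0r addr0.
have ell_sym S : S^T = S -> ell (J *m S) = 0.
  move=> ST; have -> : S = 2^-1 *: \sum_i \sum_j S i j *:
      ((delta_mx 0 i : 'rV[R]_n)^T *m (delta_mx 0 j : 'rV[R]_n)
     + (delta_mx 0 j : 'rV[R]_n)^T *m (delta_mx 0 i : 'rV[R]_n)).
    have -> : \sum_i \sum_j S i j *: ((delta_mx 0 i : 'rV[R]_n)^T *m (delta_mx 0 j : 'rV[R]_n)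
        + (delta_mx 0 j : 'rV[R]_n)^T *m (delta_mx 0 i : 'rV[R]_n)) = S + S^T.
      transitivity ((\sum_i \sum_j S i j *: delta_mx i j)
          + (\sum_i \sum_j S i j *: delta_mx i j)^T); last by rewrite -matrix_sum_delta.
      rewrite [(_)^T]linear_sum /= -big_split; apply: eq_bigr => i _.
      rewrite linear_sum /= -big_split; apply: eq_bigr => j _ /=.
      by rewrite scalerDr linearZ /= !trmx_delta !mul_delta_mx.
    by rewrite ST -mulr2n -scaler_nat scalerA mulVf ?pnatr_eq0 // scale1r.
  rewrite -scalemxAr ellZ mulmx_sumr (big_morph _ ellD ell0) big1 ?mulr0 // => i _.
  rewrite mulmx_sumr (big_morph _ ellD ell0) big1 // => j _.
  by rewrite -scalemxAr ellZ ell_polar mulr0.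
have JEJ : J *m E *m J = E by exact: acmx_conj.
(* [E] lies in the symplectic Lie algebra: E = J (E J), and E J is symmetric because E is symmetric
   and J E J = E. *)
have : ell E = 0.
  have -> : E = J *m (E *m J) by rewrite mulmxA.
  have ET : E^T = E by exact: ac_sym.
  apply: ell_sym; rewrite trmx_mul JT ET mulNmx -{1}JEJ.
  by rewrite !mulmxA JJ mulNmx mulNmx mul1mx opprK.
rewrite /ell -/r => /eqP; rewrite subr_eq0 => /eqP eqCS.
have rc : dot3 c0 r = dot3 r c0 by exact: dot3C.
rewrite rc in eqCS; set b := dot3 r c0 in eqCS rc.
exists (b / a) => i j k.
(* Equality in Cauchy-Schwarz makes the squared norm of a r - b c0 vanish. *)
have : dot3 (fun i j k => a * r i j k + - b * c0 i j k)
            (fun i j k => a * r i j k + - b * c0 i j k) = 0.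
  rewrite dot3D !dot3Z [dot3 _ r]dot3C [dot3 _ c0]dot3C !dot3D !dot3Z rc -/a -/b.
  have -> : dot3 r r = b * b / a by apply: (mulIf c00); rewrite eqCS -/r mulfVK.
  by field.
move=> /dot3_eq0 /(_ i j k) /eqP; rewrite mulNr subr_eq0 => /eqP eqr.
by apply: (mulfI c00); rewrite -/r eqr mulrA mulrCA mulfV // mulr1.
Qed.

End Complex.
End Bracket.

(** * Variations of the metric by symplectomorphisms *)

Section MatrixOf.
Variables (R : realType) (V : vectType R) (g : {dot V for idfun}).
Variables (n : nat) (e : 'I_n -> V).
Hypothesis eON : orthonormal_basis g e.
Implicit Types f h : 'End(V).

(* Row i holds the coordinates of f (e i), so composition is reversed in mxg_comp. *)
Definition mxg f : 'M[R]_n := \matrix_(i, j) g (f (e i)) (e j).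

Lemma mxg_comp f h : mxg (f \o h)%VF = mxg h *m mxg f.
Proof.
apply/matrixP => i j; rewrite !mxE comp_lfunE (parseval_lin eON) => [|c X Y]; last exact: linearP.
by apply: eq_bigr => k _; rewrite !mxE.
Qed.

Lemma mxg1 : mxg \1%VF = 1%:M.
Proof. by apply/matrixP => i j; rewrite !mxE id_lfunE eON.1. Qed.

Lemma mxg_lin c f h : mxg (c *: f + h) = c *: mxg f + mxg h.
Proof. by apply/matrixP => i j; rewrite !mxE add_lfunE scale_lfunE linearPl. Qed.

Lemma mxgD f h : mxg (f + h) = mxg f + mxg h.
Proof. by have := mxg_lin 1 f h; rewrite !scale1r. Qed.

Lemma mxgZ c f : mxg (c *: f) = c *: mxg f.
Proof. by apply/matrixP => i j; rewrite !mxE scale_lfunE linearZl_LR. Qed.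

Lemma lftrace_mxg f : lftrace f = \tr (mxg f).
Proof. by rewrite (lftrace_orthonormal _ eON); apply: eq_bigr => i _; rewrite mxE. Qed.

End MatrixOf.

Section Coordinates.
Variables (R : realType) (V : vectType R) (br : {bilinear V -> V -> V}).
Variables (omega : {skew_symmetric V}) (g : {dot V for idfun}).
Variables (n : nat) (e : 'I_n -> V).
Hypothesis lie : lie_bracket br.
Hypothesis nil3 : lower_central br 3 = 0%VS.
Hypothesis eON : orthonormal_basis g e.
Hypothesis comp : compatible omega g.

Definition br_coord i j k := g (br (e i) (e j)) (e k).
Definition mxomega : 'M[R]_n := \matrix_(i, j) omega (e i) (e j).

Lemma br_coord_skew : skew3 br_coord.
Proof. by move=> i j k; rewrite /br_coord (bracketC (e i)) // linearNl. Qed.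

Lemma mxg_Jof : mxg g e (Jof omega g) = mxomega.
Proof. by apply/matrixP => i j; rewrite !mxE -JofE. Qed.

Lemma mxomega_tr : mxomega^T = - mxomega.
Proof.
apply/matrixP => i j; rewrite !mxE.
by rewrite [LHS](hermitian_subproof (s := omega)) expr1 mulN1r.
Qed.

Lemma mxomega_sqr : mxomega *m mxomega = - 1%:M.
Proof.
rewrite -mxg_Jof -(mxg_comp eON) comp -scaleN1r mxgZ mxg1 // scaleN1r.
by [].
Qed.

Lemma mxg_Ric : mxg g e (Ric br g) = ricmx br_coord.
Proof.
apply/matrixP => k l; rewrite !mxE -ricci_formE (ricci_form_nilpotent lie eON).
- congr (_ * _ + _ * _); apply: eq_bigr => i _.
    by rewrite (parseval eON); apply: eq_bigr => j _; rewrite mulrC.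
  by apply: eq_bigr => j _; rewrite mulrC.
- exact: unimodular_nilpotent.
- exact: killing_nilpotent.
Qed.

(** The identity acts on a bracket as 1 - 1 - 1 = -1, so [mxtrace_ricmx] at the identity gives the
    trace. *)
Lemma scal_br_coord : scal br g = - 4^-1 * dot3 br_coord br_coord.
Proof.
rewrite /scal (lftrace_mxg eON) mxg_Ric -[ricmx _]mulmx1 mxtrace_ricmx; last exact: br_coord_skew.
rewrite mulNr -mulrN; congr (_ * _); rewrite -mulN1r -dot3Z dot3C.
apply: eq_dot3 => // i j k; rewrite /act3.
transitivity (\sum_l ((k == l)%:R * br_coord i j l
    - (i == l)%:R * br_coord l j k - (j == l)%:R * br_coord i l k)).
  by apply: eq_bigr => l _; rewrite !mxE (eq_sym l); ring.
have D (F : 'I_n -> R) a : \sum_l (a == l)%:R * F l = F a.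
  rewrite (bigD1 a) //= eqxx mul1r big1 ?addr0 // => b /negPf ba.
  by rewrite eq_sym ba mul0r.
by rewrite !sumrB !D; ring.
Qed.

Lemma mxg_Ric_ac : mxg g e (Ric_ac br omega g) = acmx mxomega (ricmx br_coord).
Proof.
by rewrite /Ric_ac /acpart mxgZ mxgD !(mxg_comp eON) mxg_Ric mxg_Jof mulmxA.
Qed.

Lemma lftrace_Ric_ac :
  lftrace (Ric_ac br omega g \o Ric_ac br omega g)%VF =
  \tr (acmx mxomega (ricmx br_coord) *m acmx mxomega (ricmx br_coord)).
Proof. by rewrite (lftrace_mxg eON) (mxg_comp eON) mxg_Ric_ac. Qed.

End Coordinates.

Section Pullback.
Variables (R : realType) (V : vectType R) (g : {dot V for idfun}) (phi : 'End(V)).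
Hypothesis phi_inj : forall X, phi X = 0 -> X = 0.

Definition pullback X Y : R := g (phi X) (phi Y).

Lemma pullback_bilinear : bilinear_for *%R (idfun \; *%R) pullback.
Proof.
by split=> Z c X Y; rewrite /pullback linearP ?linearPl ?linearPr.
Qed.

Lemma pullback_sym X Y : pullback X Y = (-1) ^+ false * idfun (pullback Y X).
Proof. by rewrite expr0 mul1r /pullback dotC. Qed.

Lemma pullback_gt0 X : X != 0 -> 0 < pullback X X.
Proof.
by move=> X0; apply: neq0_dnorm_gt0; apply: contra_neq X0 => /phi_inj.
Qed.

Lemma pullback_dot : exists g' : {dot V for idfun}, forall X Y, g' X Y = g (phi X) (phi Y).
Proof.
pose b := bilinear_isBilinear.Build R V V R _ _ pullback pullback_bilinear.
pose h := isHermitianSesquilinear.Build R V false idfun pullback pullback_sym.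
pose d := isDotProduct.Build R V pullback pullback_gt0.
pose g' : {dot V for idfun} := HB.pack pullback b h d.
by exists g'.
Qed.
End Pullback.

Section Variation.
Variables (R : realType) (V : vectType R) (br : {bilinear V -> V -> V}).
Variables (omega : {skew_symmetric V}) (g : {dot V for idfun}).
Variables (n : nat) (e : 'I_n -> V).
Hypothesis lie : lie_bracket br.
Hypothesis nil3 : lower_central br 3 = 0%VS.
Hypothesis eON : orthonormal_basis g e.
Hypothesis comp : compatible omega g.
Implicit Types phi : 'End(V).

Definition symplectomorphism phi phi' : Prop :=
  [/\ cancel phi phi', cancel phi' phi &
      forall X Y, omega (phi X) (phi Y) = omega X Y].

(** Structure constants, in the fixed basis, of the bracket transported by [phi]; [phi'] stands for
    the inverse of [phi]. *)
Definition twist_coord phi phi' i j k := g (phi (br (phi' (e i)) (phi' (e j)))) (e k).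

Lemma twist_coord_skew phi phi' : skew3 (twist_coord phi phi').
Proof.
by move=> i j k; rewrite /twist_coord (bracketC (phi' (e i))) // linearN linearNl.
Qed.

(** The pull-back of [g] by [phi] has the orthonormal basis [phi' (e i)], in which the bracket has
    coordinates [twist_coord] and [omega] keeps its matrix, [phi] being symplectic. *)
Lemma twisted_metric phi phi' : symplectomorphism phi phi' ->
  exists2 g', compatible omega g' &
    scal br g' = - 4^-1 * dot3 (twist_coord phi phi') (twist_coord phi phi') /\
    lftrace (Ric_ac br omega g' \o Ric_ac br omega g')%VF =
      \tr (acmx (mxomega omega e) (ricmx (twist_coord phi phi')) *m
           acmx (mxomega omega e) (ricmx (twist_coord phi phi'))).
Proof.
move=> [phiK phi'K phiw].
have [|g' g'E] := @pullback_dot _ _ g phi.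
  by move=> X phiX; rewrite -(phiK X) phiX linear0.
have JE : Jof omega g' = (phi' \o Jof omega g \o phi)%VF.
  apply: operator_of_eq (dot_nondegenerate g') _ => X Y.
  by apply: etrans (esym (g'E _ _)); rewrite !comp_lfunE phi'K -JofE phiw.
have comp' : compatible omega g'.
  rewrite /compatible JE; apply/lfunP => X; rewrite !comp_lfunE phi'K.
  have := congr1 (fun f : 'End(V) => f (phi X)) comp.
  rewrite comp_lfunE => ->; rewrite !opp_lfunE !id_lfunE linearN /=.
  by rewrite phiK.
have eON' : orthonormal_basis g' (fun i => phi' (e i)).
  split=> [i j|X]; first by rewrite g'E !phi'K eON.1.
  transitivity (phi' (phi X)); first by rewrite phiK.
  rewrite {1}[phi X](eON.2) linear_sum; apply: eq_bigr => i _.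
  by rewrite linearZ /= g'E phi'K.
have cE : forall i j k, br_coord br g' (fun i => phi' (e i)) i j k = twist_coord phi phi' i j k.
  by move=> i j k; rewrite /br_coord g'E phi'K.
have wE : mxomega omega (fun i => phi' (e i)) = mxomega omega e.
  by apply/matrixP => i j; rewrite !mxE -phiw !phi'K.
have rE : ricmx (br_coord br g' (fun i => phi' (e i))) = ricmx (twist_coord phi phi').
  apply/matrixP => i j; rewrite !mxE; congr (_ * _ + _ * _).
    by do 2![apply: eq_bigr => ? _]; rewrite !cE.
  by do 2![apply: eq_bigr => ? _]; rewrite !cE.
exists g' => //; split.
  by rewrite (scal_br_coord lie nil3 eON'); congr (_ * _); apply: eq_dot3.
by rewrite (lftrace_Ric_ac omega lie nil3 eON') wE rE.
Qed.

Lemma ricmxZ a (c : 'I_n -> 'I_n -> 'I_n -> R) :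
  ricmx (fun i j k => a * c i j k) = a ^+ 2 *: ricmx c.
Proof.
apply/matrixP => k l; rewrite !mxE mulrDr !mulrA ![a ^+ 2 * _]mulrC -!mulrA !mulr_sumr.
congr (_ + _); apply: eq_bigr => i _; rewrite !mulr_sumr; apply: eq_bigr => j _; ring.
Qed.

Lemma acmxZ a J (M : 'M[R]_n) : acmx J (a *: M) = a *: acmx J M.
Proof. by rewrite /acmx -scalemxAr -scalemxAl -scalerDr !scalerA mulrC. Qed.

Lemma mxtrace_sqr_ge0 (A : 'M[R]_n) : A^T = A -> 0 <= \tr (A *m A).
Proof.
move=> AT; apply: sumr_ge0 => i _; rewrite mxE; apply: sumr_ge0 => j _.
by rewrite -{2}AT mxE -expr2 sqr_ge0.
Qed.

Local Notation ac c := (acmx (mxomega omega e) (ricmx c)).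
Local Notation c0 := (br_coord br g e).

(* Composing with dilations of the bracket by symplectomorphisms removes the
   constraint on the scalar curvature. *)
Hypothesis dilation : forall kappa, 0 < kappa -> exists psi psi',
  symplectomorphism psi psi' /\ forall X Y, psi (br X Y) = kappa *: br (psi X) (psi Y).
Hypothesis min : minimal br omega g.
Hypothesis c0_neq0 : dot3 c0 c0 != 0.

(** Scale-invariant minimality: among the twists, tr (Ric^ac)^2 / |mu|^4 is least at the given
    bracket. *)
Lemma minimal_twist phi phi' : symplectomorphism phi phi' ->
  \tr (ac c0 *m ac c0) * dot3 (twist_coord phi phi') (twist_coord phi phi') ^+ 2 <=
  \tr (ac (twist_coord phi phi') *m ac (twist_coord phi phi')) * dot3 c0 c0 ^+ 2.
Proof.
move=> phiS; set c := twist_coord phi phi'.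
have a_gt0 : 0 < dot3 c0 c0 by rewrite lt_def c0_neq0 dot3_ge0.
have [b0|b_neq0] := eqVneq (dot3 c c) 0.
  rewrite b0 expr0n mulr0 mulr_ge0 ?sqr_ge0 // mxtrace_sqr_ge0 //.
  exact/acmx_sym/ricmx_sym/mxomega_tr.
have b_gt0 : 0 < dot3 c c by rewrite lt_def b_neq0 dot3_ge0.
(* The dilation by [kappa] brings the twisted bracket to the norm of [c0], hence to equal scalar
   curvature. *)
pose kappa := Num.sqrt (dot3 c0 c0 / dot3 c c).
have k2 : kappa ^+ 2 = dot3 c0 c0 / dot3 c c by rewrite sqr_sqrtr // divr_ge0 ?ltW.
have k_gt0 : 0 < kappa by rewrite sqrtr_gt0 divr_gt0.
have [psi [psi' [[psiK psi'K psiw] psiD]]] := dilation k_gt0.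
have [phiK phi'K phiw] := phiS.
have S : symplectomorphism (phi \o psi)%VF (psi' \o phi')%VF.
  split=> [X|X|X Y]; rewrite !comp_lfunE ?phiK ?psiK ?psi'K ?phi'K //.
  by rewrite phiw psiw.
have [g' comp' [scal' tr']] := twisted_metric S.
have cE : forall i j k, twist_coord (phi \o psi)%VF (psi' \o phi')%VF i j k = kappa * c i j k.
  move=> i j k; rewrite /twist_coord !comp_lfunE psiD !psi'K linearZ linearZl_LR.
  by [].
have rE : ricmx (twist_coord (phi \o psi)%VF (psi' \o phi')%VF) = kappa ^+ 2 *: ricmx c.
  rewrite -ricmxZ; apply/matrixP => i j; rewrite !mxE; congr (_ * _ + _ * _).
    by do 2![apply: eq_bigr => ? _]; rewrite !cE.
  by do 2![apply: eq_bigr => ? _]; rewrite !cE.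
have dE : dot3 (twist_coord (phi \o psi)%VF (psi' \o phi')%VF)
               (twist_coord (phi \o psi)%VF (psi' \o phi')%VF) = dot3 c0 c0.
  rewrite (eq_dot3 cE cE) dot3Z dot3C dot3Z mulrA -expr2 k2.
  by rewrite mulfVK.
have := min.2 g' comp'; rewrite scal' dE (scal_br_coord lie nil3 eON) => /(_ erefl).
have trZ a (A : 'M[R]_n) : \tr ((a *: A) *m (a *: A)) = a * (a * \tr (A *m A)).
  by rewrite -scalemxAl -scalemxAr !mxtraceZ.
rewrite tr' rE acmxZ (lftrace_Ric_ac omega lie nil3 eON) trZ k2 => H.
rewrite -ler_pdivlMr ?exprn_gt0 //.
apply: le_trans H _; rewrite le_eqVlt; apply/orP; left; apply/eqP.
by field; rewrite gt_eqF.
Qed.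

Lemma act3_mxg (f : 'End(V)) i j k : act3 (mxg g e f) c0 i j k =
  g (f (br (e i) (e j)) - br (f (e i)) (e j) - br (e i) (f (e j))) (e k).
Proof.
rewrite !linearBl /= (parseval_lin eON (br (e i) (e j)) (e k)) => [|c X Y]; last exact: linearP.
rewrite (parseval_lin eON (f := br (e i))) => [|c X Y]; last by rewrite linearPr.
rewrite (parseval_lin eON (f := fun X => br X (e j))) => [|c X Y]; last by rewrite linearPl.
by rewrite /act3 -!sumrB; apply: eq_bigr => l _; rewrite !mxE.
Qed.

(** The infinitesimal generator: the symplectic transvections are 1 + s T, with inverse 1 - s T
    because T squares to zero. *)
Definition transvection (w : V) : 'End(V) := linfun (fun X => omega X w *: w).

Lemma transvectionE w X : transvection w X = omega X w *: w.
Proof.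
have L : linear (fun X => omega X w *: w).
  by move=> c Y Z; rewrite linearPl /= scalerDl scalerA.
pose f : {linear V -> V} := HB.pack (fun X => omega X w *: w)
  (GRing.isLinear.Build R V V _ _ L).
exact: (lfunE f).
Qed.

Let omegaC X Y : omega Y X = - omega X Y.
Proof. by rewrite [LHS](hermitian_subproof (s := omega)) expr1 mulN1r. Qed.

Let omegaxx X : omega X X = 0.
Proof. by have := omegaC X X; lra. Qed.

Lemma transvection_sqr w X : transvection w (transvection w X) = 0.
Proof. by rewrite !transvectionE linearZl_LR /= omegaxx mulr0 scale0r. Qed.

Lemma transvection_symplectic w s :
  symplectomorphism (\1 + s *: transvection w)%VF (\1 - s *: transvection w)%VF.
Proof.
have TK a X : transvection w (X + a *: transvection w X) = transvection w X.
  by rewrite linearD /= linearZ /= transvection_sqr scaler0 addr0.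
split=> [X|X|X Y]; rewrite !(add_lfunE, opp_lfunE, scale_lfunE, id_lfunE).
- by rewrite TK addrK.
- by rewrite -scaleNr TK scaleNr subrK.
rewrite !transvectionE !(linearDl, linearDr, linearZl_LR, linearZr_LR) /= omegaxx.
by rewrite (omegaC w Y) (omegaC w X); ring.
Qed.

Lemma minimal_derivation : exists lambda, forall X Y,
  let E := Ric_ac br omega g in
  E (br X Y) - br (E X) Y - br X (E Y) = lambda *: br X Y.
Proof.
have [lambda lE] : exists lambda, forall i j k, act3 (ac c0) c0 i j k = lambda * c0 i j k.
  apply: act3_eigen => //; [exact: mxomega_tr|exact: mxomega_sqr eON comp|exact: br_coord_skew|].
  move=> v d; pose w := \sum_i v 0 i *: e i.
  have NE : mxomega omega e *m (v^T *m v) = mxg g e (transvection w).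
    apply/matrixP => i l; rewrite mulmxA !mxE big_ord1 transvectionE linearZl_LR /=.
    congr (_ * _).
      rewrite !mxE linear_sumr; apply: eq_bigr => a _.
      by rewrite !mxE linearZr_LR /= mulrC.
    rewrite linear_sumlz (bigD1 l) //= linearZl_LR /= eON.1 eqxx.
    rewrite mulr1 big1 ?addr0 // => a /negPf al.
    by rewrite linearZl_LR /= eON.1 al mulr0.
  apply: (@critical_direction _ _ _ (mxomega_tr omega e) (mxomega_sqr eON comp)
    (fun s => twist_coord (\1 + s *: transvection w)%VF (\1 - s *: transvection w)%VF) c0 d).
  - move=> i j k; rewrite /d NE act3_mxg; set T := transvection w.
    (* The twisted bracket is cubic in [s]; the witness collects its coefficients of s^2 and s^3. *)
    exists ((g (br (T (e i)) (T (e j))) (e k) - g (T (br (T (e i)) (e j))) (e k)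
             - g (T (br (e i) (T (e j)))) (e k))%:P
            + g (T (br (T (e i)) (T (e j)))) (e k) *: 'X) => s.
    rewrite /twist_coord !(add_lfunE, opp_lfunE, scale_lfunE, id_lfunE) -/T.
    rewrite !(linearBl, linearBr, linearZl_LR, linearZr_LR) /=.
    rewrite !(linearB, linearZ) /= !(linearBl, linearDl, linearZl_LR, linearBl) /=.
    rewrite !(linearD, linearZ, linearN) /= !(linearNl, linearDl, linearZl_LR) /=.
    rewrite hornerD hornerC hornerZ hornerX /br_coord; ring.
  - by move=> s; apply: twist_coord_skew.
  - exact: br_coord_skew.
  - exact/act3_skew/br_coord_skew.
  - exact: c0_neq0.
  - by move=> s; apply/minimal_twist/transvection_symplectic.
exists lambda => X Y E.
(* [F] is bilinear, so its vanishing on the basis vectors suffices. *)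
pose F X Y := E (br X Y) - br (E X) Y - br X (E Y) - lambda *: br X Y.
apply/eqP; rewrite -subr_eq0 -/(F X Y); apply/eqP.
have lin2 a (p q p' q' : V) : a *: p + p' + (a *: q + q') = a *: (p + q) + (p' + q').
  by rewrite addrACA scalerDr.
have Fl Y0 : linear (F^~ Y0).
  by move=> a A B; rewrite /F !(linearPl, linearP) /= !lin2.
have Fr X0 : linear (F X0).
  by move=> a A B; rewrite /F !(linearPr, linearP) /= !lin2.
apply: (@dot_inj _ _ g) => Z; rewrite linear0l (parseval_lin eON _ _ (Fl Y)).
rewrite big1 // => i _; rewrite (parseval_lin eON _ _ (Fr _)) big1 ?mulr0 // => j _.
rewrite [X in _ * X](parseval eON) big1 ?mulr0 // => k _.
have := lE i j k; rewrite -mxg_Ric_ac // act3_mxg -/E /F => eqE.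
apply/eqP; rewrite mulf_eq0 linearBl subr_eq0; apply/orP; left; apply/eqP.
by apply: etrans eqE _; rewrite linearZl_LR.
Qed.
End Variation.

(** * From derivations to solitons *)

Section Soliton.
Variables (R : realType) (V : vectType R) (br : {bilinear V -> V -> V}).
Variables (omega : {skew_symmetric V}) (g : {dot V for idfun}).
Hypothesis lie : lie_bracket br.
Hypothesis nil3 : lower_central br 3 = 0%VS.
Hypothesis symp : symplectic br omega.
Hypothesis comp : compatible omega g.
Implicit Types X Y Z : V.

Local Notation J := (Jof omega g).
Local Notation P := (chern_ricci br omega J).

Let JJ X : J (J X) = - X.
Proof.
have := congr1 (fun f : 'End(V) => f X) comp.
by rewrite comp_lfunE opp_lfunE id_lfunE.
Qed.

Let omegaC X Y : omega Y X = - omega X Y.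
Proof. by rewrite [LHS](hermitian_subproof (s := omega)) expr1 mulN1r. Qed.

Let Jskew X Y : g (J X) Y = - g X (J Y).
Proof. by rewrite -JofE omegaC (JofE omega g) dotC. Qed.

(** By unimodularity only - tr (J ad Z) / 2 at Z = [X,Y] is left, and this vanishes together with ad
    Z. *)
Lemma chern_ricci_functional : exists theta : V -> R,
  [/\ linear (theta : V -> R^o), (forall Z, (forall X, br Z X = 0) -> theta Z = 0) &
      forall X Y, omega (P X) Y = theta (br X Y)].
Proof.
exists (fun Z => - 2^-1 * lftrace (J \o ad br Z)%VF); split.
- move=> c X Y /=; rewrite ad_linear comp_lfunDr -comp_lfunZr lftrace_linear.
  by rewrite /GRing.scale /=; ring.
- move=> Z Z0; suff -> : ad br Z = 0 by rewrite comp_lfun0r lftrace0 mulr0.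
  by apply/lfunP => X; rewrite adE Z0 zero_lfunE.
move=> X Y; rewrite -chern_ricciE ?symp.1 // /chern_ricci_form.
by rewrite unimodular_nilpotent // sub0r mulrN mulNr.
Qed.

Lemma chern_ricci_selfadjoint X Y : omega (P X) Y = omega X (P Y).
Proof.
have [theta [theta_lin _ PE]] := chern_ricci_functional.
rewrite (omegaC (P Y)) !PE (bracketC X Y) //.
have := theta_lin (-1) (br X Y) 0; rewrite addr0 scaleN1r => ->.
have -> : theta 0 = 0.
  by have := theta_lin (-1) 0 0; rewrite scaler0 addr0 scaleN1r addNr.
by rewrite addr0 scaleN1r opprK.
Qed.

Lemma Ric_ac_sym X Y : g (Ric_ac br omega g X) Y = g X (Ric_ac br omega g Y).
Proof.
have [e eON] := orthonormal_basis_exists g.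
have Rsym Z W : g (Ric br g Z) W = g Z (Ric br g W).
  rewrite (dotC _ Z) -!ricci_formE.
  rewrite !(ricci_form_nilpotent lie eON) //; try exact: unimodular_nilpotent;
    try exact: killing_nilpotent.
  congr (_ * _ + _ * _); apply: eq_bigr => i _; first by rewrite dotC.
  by apply: eq_bigr => j _; rewrite mulrC.
rewrite /Ric_ac /acpart !(scale_lfunE, add_lfunE, comp_lfunE).
rewrite linearZl_LR linearZr_LR linearDl linearDr /= Rsym.
by rewrite Jskew Rsym Jskew opprK.
Qed.

Lemma Ric_ac_conj X : J (Ric_ac br omega g (J X)) = Ric_ac br omega g X.
Proof.
rewrite /Ric_ac /acpart !(scale_lfunE, add_lfunE, comp_lfunE) linearZ linearD /=.
by rewrite !JJ !linearN /= opprK addrC.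
Qed.

(* The derivation of the soliton is Ric_ac + lambda + P and the constant is - lambda. *)
Lemma soliton_of_derivation lambda :
  (forall X Y, let E := Ric_ac br omega g in
     E (br X Y) - br (E X) Y - br X (E Y) = lambda *: br X Y) ->
  derivation br P -> soliton br omega g.
Proof.
move=> Eder Pder; split; first by split.
move=> J0 P0; rewrite {}/P0 {}/J0; have := Ric_ac_conj; have := Ric_ac_sym.
move: (Ric_ac br omega g) Eder => E Eder Esym Econj.
pose D := E + lambda *: \1%VF + P.
have DE X : D X = E X + lambda *: X + P X.
  by rewrite !add_lfunE scale_lfunE id_lfunE.
(* The transpose of [P] is - J P J, because [P] is self-adjoint for [omega]. *)
have DtE X : lftranspose g D X = E X + lambda *: X - J (P (J X)).
  apply: (@dot_inj _ _ g) => Y; rewrite lftransposeE DE.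
  rewrite !linearDr !linearDl linearNl linearZl_LR linearZr_LR /=; congr (_ + _ + _).
    by rewrite Esym.
  rewrite -JofE chern_ricci_selfadjoint (JofE omega g) JJ linearNl /=.
  by rewrite opprK.
clearbody D; exists (- lambda), D; split.
- move=> X Y; rewrite !DE Pder !(linearDl, linearDr, linearZl_LR, linearZr_LR) /=.
  have -> : E (br X Y) = lambda *: br X Y + br X (E Y) + br (E X) Y.
    by rewrite -Eder !subrK.
  set a := br X (E Y); set b := br (E X) Y; set c := lambda *: br X Y.
  apply: (@dot_inj _ _ g) => Z; rewrite !linearDl /=; ring.
- apply/lfunP => X; apply: (@dot_inj _ _ g) => Z.
  rewrite !(add_lfunE, opp_lfunE, scale_lfunE, id_lfunE, comp_lfunE) DtE DE.
  have -> : J (E (J X) + lambda *: J X - J (P (J (J X)))) = E X - lambda *: X - P X.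
    have -> : J (P (J (J X))) = - J (P X) by rewrite JJ (linearN P) (linearN J).
    by rewrite opprK !(linearD J) /= Econj (linearZ_LR J) /= !JJ scalerN.
  rewrite !(linearDl, linearNl, linearZl_LR) /=; by field.
- apply/lfunP => X; apply: (@dot_inj _ _ g) => Z.
  rewrite /cpart !(add_lfunE, opp_lfunE, scale_lfunE, id_lfunE, comp_lfunE) DtE DE.
  rewrite !(linearDl, linearNl, linearZl_LR) /=; by field.
Qed.
End Soliton.

(** * Three-step symplectic Lie algebras of dimension six *)

Section Structure.
Variables (R : realType) (V : vectType R) (br : {bilinear V -> V -> V}).
Hypothesis lie : lie_bracket br.
Hypothesis nil3 : lower_central br 3 = 0%VS.
Implicit Types X Y Z U W A B : V.

Definition central Z : Prop := forall X, br Z X = 0.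

Lemma brxx X : br X X = 0. Proof. exact: lie.1. Qed.

Lemma brC X Y : br Y X = - br X Y. Proof. exact: bracketC. Qed.

Lemma jacobi X Y Z : br (br X Y) Z + br (br Y Z) X + br (br Z X) Y = 0.
Proof.
have := lie.2 X Y Z; rewrite (brC (br Y Z)) (brC (br Z X)) (brC (br X Y)).
by rewrite -!opprD => /eqP; rewrite oppr_eq0 => /eqP sum0; rewrite -addrA addrC.
Qed.

Lemma br3_central X Y Z : central (br (br X Y) Z).
Proof.
by move=> W; rewrite brC (brC Z (br X Y)) linearNr bracket4_eq0 // !oppr0.
Qed.

Lemma br_central_r Z X : central Z -> br X Z = 0.
Proof. by move=> Z0; rewrite brC Z0 oppr0. Qed.

Lemma centralD Z W : central Z -> central W -> central (Z + W).
Proof. by move=> Z0 W0 X; rewrite linearDl Z0 W0 addr0. Qed.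

Lemma centralZ a Z : central Z -> central (a *: Z).
Proof. by move=> Z0 X; rewrite linearZl_LR Z0 scaler0. Qed.

Lemma centralN Z : central Z -> central (- Z).
Proof. by move=> Z0 X; rewrite linearNl Z0 oppr0. Qed.

Lemma br_space_ind (Q : V -> Prop) (U W : {vspace V}) :
  Q 0 -> (forall a X Y, Q X -> Q Y -> Q (a *: X + Y)) ->
  (forall X Y, X \in U -> Y \in W -> Q (br X Y)) ->
  forall A, A \in br_space br U W -> Q A.
Proof.
move=> Q0 QP Qbr A; rewrite /br_space => /(coord_span (X := in_tuple _)) ->.
elim/big_rec: _ => // i X _ QX; apply: QP => //.
have /allpairsP[[u w] /= [Uu Ww ->]] :
  (in_tuple [seq br u w | u <- vbasis U, w <- vbasis W])`_i \in
    [seq br u w | u <- vbasis U, w <- vbasis W] by exact: mem_nth.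
by apply: Qbr; exact: vbasis_mem.
Qed.

Lemma noncentral_bracket : lower_central br 2 <> 0%VS -> exists X Y, ~ central (br X Y).
Proof.
move=> c2; apply: contrapT => all_central; apply: c2.
have C X Y : central (br X Y) by apply: contrapT => XY; apply: all_central; exists X, Y.
apply/eqP; rewrite -subv0; apply/subvP => A A2; rewrite memv0; apply/eqP; move: A A2.
apply: br_space_ind => // [a X Y -> ->|X A _]; first by rewrite scaler0 addr0.
move: A; apply: br_space_ind => [|a Y Z Y0 Z0|Y Z _ _].
- exact: linear0r.
- by rewrite linearPr Y0 Z0 scaler0 addr0.
- exact/br_central_r/C.
Qed.

Section Generator.
Variable omega : {skew_symmetric V}.
Hypothesis symp : symplectic br omega.
Hypothesis dim6 : \dim {:V} = 6%N.

Lemma omegaC X Y : omega Y X = - omega X Y.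
Proof. by rewrite [LHS](hermitian_subproof (s := omega)) expr1 mulN1r. Qed.

Lemma omegaxx X : omega X X = 0.
Proof. by have := omegaC X X; lra. Qed.

Lemma omega_nd X : (forall Y, omega X Y = 0) -> X = 0.
Proof.
move=> X0; apply/eqP; rewrite -memv0 -(eqP symp.1); apply/mem_orthovP => Y _.
exact: X0.
Qed.

Lemma omega_inj X Y : (forall Z, omega X Z = omega Y Z) -> X = Y.
Proof.
move=> XY; apply/eqP; rewrite -subr_eq0; apply/eqP/omega_nd => Z.
by rewrite linearBl /= XY subrr.
Qed.

Lemma omega_central Z X Y : central Z -> omega (br X Y) Z = 0.
Proof.
by move=> Z0; have := symp.2 X Y Z; rewrite Z0 (br_central_r _ Z0) !linear0l !addr0.
Qed.

(** By three-step nilpotency and the Jacobi identity [V,V] is abelian. Decomposing X and Y by [gen]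
    leaves a multiple of [x,y] and brackets of combinations of [x], [y] with [V,V]. *)
Lemma derived_two_generators x y :
  (forall X, exists a b, X - (a *: x + b *: y) \in br_space br fullv fullv) ->
  forall X Y, exists r a b,
    br X Y = r *: br x y + a *: br x (br x y) + b *: br y (br x y).
Proof.
move=> gen.
set c1 := br_space br fullv fullv in gen *.
have c1_ind (Q : V -> Prop) : Q 0 -> (forall a X Y, Q X -> Q Y -> Q (a *: X + Y)) ->
    (forall X Y, Q (br X Y)) -> forall A, A \in c1 -> Q A.
  by move=> Q0 QP Qbr; apply: br_space_ind => // X Y _ _.
have br_c1_central W C : C \in c1 -> central (br C W).
  move: C; apply: c1_ind => [|a A B A0 B0|X Y]; last exact: br3_central.
  - by move=> U; rewrite !linear0l.
  - by move=> U; rewrite linearPl linearPl A0 B0 scaler0 addr0.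
have brD A B : A \in c1 -> B \in c1 -> br A B = 0.
  move=> A1; move: B; apply: c1_ind => [|a B B' B0 B'0|B B'].
  - exact: linear0r.
  - by rewrite linearPr B0 B'0 scaler0 addr0.
  have := jacobi A B B'; rewrite (br_c1_central B A A1) (brC A B') linearNl.
  by rewrite (br_c1_central B' A A1) oppr0 add0r addr0 brC => /eqP; rewrite oppr_eq0 => /eqP.
have br2 a b a' b' : br (a *: x + b *: y) (a' *: x + b' *: y) = (a * b' - b * a') *: br x y.
  rewrite !(linearDl, linearDr, linearZl_LR, linearZr_LR) /= !brxx (brC x y).
  by rewrite !scaler0 addr0 add0r !scalerN !scalerA scalerBl.
have dec X Y : exists a b a' b' A B, [/\ A \in c1, B \in c1 & br X Y =
    (a * b' - b * a') *: br x y + br (a *: x + b *: y) B - br (a' *: x + b' *: y) A].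
  have [[a [b XA]] [a' [b' YB]]] := (gen X, gen Y).
  exists a, b, a', b', (X - (a *: x + b *: y)), (Y - (a' *: x + b' *: y)); split=> //.
  move: XA YB; set A := X - _; set B := Y - _ => A1 B1.
  have -> : X = a *: x + b *: y + A by rewrite /A addrC subrK.
  have -> : Y = a' *: x + b' *: y + B by rewrite /B addrC subrK.
  rewrite linearDl (linearDr br (a *: x + b *: y)) (linearDr br A) (brD A B) // addr0 br2.
  by rewrite [br A _]brC.
(* Bracketing with an element of [V,V] sees only its class modulo the center, which is a multiple of
   that of [br x y]. *)
have mod_w A : A \in c1 -> exists r, forall U, br U A = r *: br U (br x y).
  move: A; apply: c1_ind => [|a A B [r Ar] [s Bs]|X Y].
  - by exists 0 => U; rewrite linear0r scale0r.
  - by exists (a * r + s) => U; rewrite linearPr Ar Bs scalerA scalerDl.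
  have [a [b [a' [b' [A [B [A1 B1 ->]]]]]]] := dec X Y.
  exists (a * b' - b * a') => U.
  rewrite (brC B) (brC A) 2!linearDr !linearNr linearZr_LR /=.
  rewrite (br_central_r U (br_c1_central _ B B1)) (br_central_r U (br_c1_central _ A A1)).
  by rewrite !oppr0 !addr0.
move=> X Y; have [a [b [a' [b' [A [B [A1 B1 ->]]]]]]] := dec X Y.
have [[r Ar] [s Bs]] := (mod_w A A1, mod_w B B1).
exists (a * b' - b * a'), (s * a - r * a'), (s * b - r * b').
rewrite Ar Bs !(linearDl, linearZl_LR) /= -!addrA; congr (_ + _).
by rewrite !scalerBl !scalerDr !scalerA opprD addrACA -!addrA.
Qed.

Lemma dim_derived_two_generators x y :
  (forall X, exists a b, X - (a *: x + b *: y) \in br_space br fullv fullv) ->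
  (\dim (br_space br fullv fullv) <= 3)%N.
Proof.
move=> gen; apply: leq_trans (_ : \dim <<[:: br x y; br x (br x y); br y (br x y)]>> <= _)%N;
  last exact: dim_span.
apply: dimvS; apply/subvP; apply: br_space_ind => [|a X Y XS YS|X Y _ _].
- exact: mem0v.
- by rewrite memvD ?memvZ.
have [r [a [b ->]]] := derived_two_generators gen X Y.
by rewrite !memvD ?memvZ // memv_span // !inE eqxx ?orbT.
Qed.

(** If [V,V] had dimension at least 4, a complement would have dimension at most 2, so two vectors
    would span V modulo [V,V] and [dim_derived_two_generators] would apply. *)
Lemma dim_derived : (\dim (br_space br fullv fullv) <= 3)%N.
Proof.
set c1 := br_space _ _ _; rewrite leqNgt; apply/negP => c1_gt3.
suff : (\dim c1 <= 3)%N by rewrite leqNgt c1_gt3.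
have dimC : (\dim c1^C <= 2)%N.
  by rewrite dimv_compl dim6 leq_subLR addn2 !ltnS.
have [s s_size sC] : exists2 s : seq V, (size s <= 2)%N & c1^C%VS = <<s>>%VS.
  exists (vbasis c1^C); first by rewrite size_tuple.
  by rewrite (span_basis (vbasisP _)).
suff [x [y xy]] : exists x y, forall B, B \in <<s>>%VS -> exists a b, B = a *: x + b *: y.
  apply: (@dim_derived_two_generators x y) => X.
  have : X \in (c1 + c1^C)%VS by rewrite addv_complf memvf.
  rewrite sC => /memv_addP[A A1 [B /xy[a [b ->]] ->]].
  by exists a, b; rewrite addrK.
case: s s_size {sC} => [|x [|y [|//]]] _.
- exists 0, 0 => B; rewrite span_nil memv0 => /eqP ->.
  by exists 0, 0; rewrite !scale0r addr0.
- exists x, 0 => B; rewrite span_seq1 => /vlineP[a ->].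
  by exists a, 0; rewrite scaler0 addr0.
- exists x, y => B; rewrite span_cons span_seq1.
  by move=> /memv_addP[_ /vlineP[a ->] [_ /vlineP[b ->] ->]]; exists a, b.
Qed.

(* If A = [X1,Y1] is a counterexample, [V,V] = <xi, zeta, A> with xi central and zeta, A independent
   modulo the center. Write [B,X] = mu B X *: xi for B in [V,V] and
   eta = omega xi. Closedness gives omega(B,[X,Y]) = N B X * eta Y - N B Y * eta X
   with N B = mu B - mu B e * eta, and both the isotropic and the non-isotropic
   case for [V,V] are contradictory. *)
Lemma derived_generator : lower_central br 2 <> 0%VS -> exists X0 Y0,
  ~ central (br X0 Y0) /\
  forall X Y, exists r, central (br X Y - r *: br X0 Y0).
Proof.
move=> /noncentral_bracket[X0 [Y0 zeta_nc]]; exists X0, Y0; split=> //.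
set zeta := br X0 Y0 in zeta_nc *.
move=> X1 Y1; apply: contrapT => A_indep; set A := br X1 Y1 in A_indep.
have [U0 xi_neq0] : exists U0, br zeta U0 != 0.
  apply: contrapT => H; apply: zeta_nc => X; apply/eqP/negPn/negP => zX.
  by apply: H; exists X.
set xi := br zeta U0 in xi_neq0.
have xi_c : central xi by exact: br3_central.
have indep a b c : central (a *: xi + b *: zeta + c *: A) -> b = 0 /\ c = 0.
  move=> H; have c0 : c = 0.
    apply/eqP/negPn/negP => c0; apply: A_indep; exists (- (b / c)).
    have := centralZ c^-1 (centralD H (centralN (centralZ a xi_c))).
    rewrite -!addrA addrC -!addrA addNr addr0 scalerDr !scalerA mulVf // scale1r.
    by rewrite addrC scaleNr opprK mulrC.
  split=> //; apply/eqP/negPn/negP => b0; apply: zeta_nc.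
  have := centralZ b^-1 (centralD H (centralN (centralZ a xi_c))).
  rewrite c0 scale0r addr0 [_ *: xi + _]addrC addrK scalerA mulVf // scale1r.
  by [].
have c1mem X Y : br X Y \in br_space br fullv fullv by rewrite mem_br_space ?memvf.
(* As [V,V] has dimension at most 3, freeness makes these three brackets a basis of it. *)
have free3 : free [:: xi; zeta; A].
  change (free [tuple xi; zeta; A]); apply/freeP => c.
  rewrite !big_ord_recl big_ord0 /= addr0 addrA.
  move=> c0; have C : central (c ord0 *: xi + c (lift ord0 ord0) *: zeta
      + c (lift ord0 (lift ord0 ord0)) *: A) by rewrite c0 => X; rewrite linear0l.
  have [c1 c2] := indep _ _ _ C; move: c0; rewrite c1 c2 !scale0r !addr0 => /eqP.
  rewrite scaler_eq0 (negPf xi_neq0) orbF => /eqP c00.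
  case=> [[|[|[|//]]] i3]; [rewrite -[RHS]c00|rewrite -[RHS]c1|rewrite -[RHS]c2];
    by congr c; apply: val_inj.
have spanE X Y : exists a b c, br X Y = a *: xi + b *: zeta + c *: A.
  have : br X Y \in <<[:: xi; zeta; A]>>%VS.
    suff -> : <<[:: xi; zeta; A]>>%VS = br_space br fullv fullv by [].
    apply/eqP; rewrite eqEdim (eqP free3) dim_derived andbT; apply/span_subvP => B.
    by rewrite !inE => /or3P[] /eqP ->; exact: c1mem.
  rewrite !span_cons span_nil addv0.
  move=> /memv_addP[_ /vlineP[a ->] [_ /memv_addP[_ /vlineP[b ->] [_ /vlineP[c ->] ->]] ->]].
  by exists a, b, c; rewrite addrA.
have [e eta_e] : exists e, omega xi e = 1.
  apply: contrapT => H; move/eqP: xi_neq0; apply; apply: omega_nd => Y.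
  apply/eqP/negPn/negP => xiY; apply: H; exists ((omega xi Y)^-1 *: Y).
  by rewrite linearZr_LR /= mulVf.
have mu X Y : exists m : V -> R, forall Z, br (br X Y) Z = m Z *: xi.
  suff /choice[m mE] : forall Z, exists r, br (br X Y) Z = r *: xi by exists m.
  move=> Z; have [a [b [c E]]] := spanE (br X Y) Z.
  have [b0 c0] : b = 0 /\ c = 0 by apply: (@indep a); rewrite -E; apply: br3_central.
  by exists a; rewrite E b0 c0 !scale0r !addr0.
have [mz mzE] := mu X0 Y0; have [ma maE] := mu X1 Y1.
have xi_br X Y : omega xi (br X Y) = 0 by rewrite omegaC omega_central ?oppr0.
have closed B (m : V -> R) X Y : (forall Z, br B Z = m Z *: xi) ->
    omega B (br X Y) = m X * omega xi Y - m Y * omega xi X.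
  move=> mE; have := symp.2 B X Y; rewrite (brC B Y) !mE linearNl !linearZl_LR /=.
  by rewrite (omegaC B); lra.
have kerE X Y : omega xi X = 0 -> omega xi Y = 0 ->
    omega zeta (br X Y) = 0 /\ omega A (br X Y) = 0.
  by move=> X0' Y0'; rewrite (closed _ _ _ _ mzE) (closed _ _ _ _ maE) X0' Y0' !mulr0 subrr.
have shift X : omega xi (X - omega xi X *: e) = 0.
  by rewrite linearBr linearZr_LR /= eta_e mulr1 subrr.
have [zA0|zA_neq0] := eqVneq (omega zeta A) 0.
  have iso X Y : omega zeta (br X Y) = 0 /\ omega A (br X Y) = 0.
    have [a [b [c ->]]] := spanE X Y.
    rewrite !linearDr !linearZr_LR /= zA0 !omegaxx (omegaC xi) xi_br.
    by rewrite (omegaC xi) xi_br (omegaC zeta A) zA0 oppr0 !mulr0 !addr0.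
  have mE B (m : V -> R) : (forall Z, br B Z = m Z *: xi) ->
      (forall X Y, omega B (br X Y) = 0) -> forall X, m X = m e * omega xi X.
    move=> mE B0 X; have := closed B m X e mE; rewrite B0 eta_e mulr1; lra.
  have mzE' := mE _ _ mzE (fun X Y => (iso X Y).1).
  have maE' := mE _ _ maE (fun X Y => (iso X Y).2).
  (* The vector [ma e *: zeta - mz e *: A] is central, so both coefficients vanish by [indep], and
     then [zeta] would be central. *)
  have [b0 c0] : ma e = 0 /\ - mz e = 0.
    apply: (@indep 0) => X; rewrite scale0r add0r linearDl !linearZl_LR /= mzE maE.
    by rewrite (mzE' X) (maE' X) !scalerA -scalerDl (_ : _ + _ = 0) ?scale0r //; ring.
  apply: zeta_nc => X; rewrite mzE (mzE' X); move/eqP: c0; rewrite oppr_eq0 => /eqP ->.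
  by rewrite mul0r scale0r.
have kerC X Y : omega xi X = 0 -> omega xi Y = 0 -> exists a, br X Y = a *: xi.
  move=> Xk Yk; have [] := kerE X Y Xk Yk; have [a [b [c ->]]] := spanE X Y.
  rewrite !linearDr !linearZr_LR /= !omegaxx (omegaC xi) xi_br (omegaC xi) xi_br.
  rewrite (omegaC zeta A) !oppr0 !mulr0 !add0r !addr0 mulrN => /eqP.
  rewrite mulf_eq0 (negPf zA_neq0) orbF => /eqP -> /eqP.
  rewrite oppr_eq0 mulf_eq0 (negPf zA_neq0) orbF => /eqP ->.
  by exists a; rewrite !scale0r !addr0.
(* For X and Y in the kernel of [omega xi], the Jacobi identity with [e] gives [mX Y = mY X]. By
   [closed] these are the values of [omega] on [X,e], [Y,e] in the two orders, which are
   opposite. *)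
have isoe X Y : omega (br X e) (br Y e) = 0.
  wlog Xk : X / omega xi X = 0 => [H|].
    have := H (X - omega xi X *: e) (shift X).
    by rewrite linearBl linearZl_LR /= brxx scaler0 subr0.
  wlog Yk : Y / omega xi Y = 0 => [H|].
    have := H (Y - omega xi Y *: e) (shift Y).
    by rewrite linearBl linearZl_LR /= brxx scaler0 subr0.
  have [mX mXE] := mu X e; have [mY mYE] := mu Y e.
  have := jacobi X Y e; have [a ->] := kerC X Y Xk Yk.
  rewrite linearZl_LR /= xi_c scaler0 add0r mYE (brC X e) linearNl mXE.
  rewrite -scalerBl => /eqP; rewrite scaler_eq0 (negPf xi_neq0) orbF subr_eq0 => /eqP mXY.
  have H1 := closed _ _ X e mYE; have H2 := closed _ _ Y e mXE.
  move: H1 H2; rewrite eta_e Xk Yk !mulr1 !mulr0 !subr0 (omegaC (br X e)) mXY.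
  move=> H1 H2; move: H1; rewrite H2; lra.
have iso X Y Z W : omega (br X Y) (br Z W) = 0.
  (* Projecting P and Q along [e] to the kernel of [omega xi] changes [P,Q] by a bracket with [e],
     and [kerC] handles the rest. *)
  have dec P Q : exists a S, br P Q = a *: xi + br S e.
    have := kerC _ _ (shift P) (shift Q) => -[a aE].
    exists a, (omega xi Q *: P - omega xi P *: Q); rewrite -aE.
    apply: omega_inj => Z'; rewrite !(linearBl, linearBr, linearZl_LR, linearZr_LR) /=.
    rewrite !brxx (brC Q e).
    rewrite !(linearDl, linearNl, linearZl_LR, linear0l) /=; ring.
  have [a [S ->]] := dec X Y; have [b [T ->]] := dec Z W.
  rewrite !(linearDl, linearDr, linearZl_LR, linearZr_LR) /= isoe !xi_br ?omegaxx.
  by rewrite (omegaC xi) xi_br oppr0 !mulr0 !addr0.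
by move/eqP: zA_neq0; apply; apply: iso.
Qed.
End Generator.
End Structure.

(** * Adapted Darboux bases and the components of the bracket *)

Section Adapted.
Variables (R : realType) (V : vectType R) (br : {bilinear V -> V -> V}).
Variable omega : {skew_symmetric V}.
Hypothesis lie : lie_bracket br.
Hypothesis symp : symplectic br omega.
Hypothesis dim6 : \dim {:V} = 6%N.
Implicit Types X Y Z U W A B : V.

Local Notation w := omega.
Local Notation T X Y Z := (omega (br X Y) Z).

Record darboux (p t q fp z fq : V) : Prop := Darboux {
  w_p_fp : w p fp = 1; w_t_z : w t z = 1; w_q_fq : w q fq = 1;
  w_p_z : w p z = 0; w_p_fq : w p fq = 0; w_t_fp : w t fp = 0;
  w_t_fq : w t fq = 0; w_q_fp : w q fp = 0; w_q_z : w q z = 0;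
  w_p_t : w p t = 0; w_p_q : w p q = 0; w_t_q : w t q = 0;
  w_fp_z : w fp z = 0; w_fp_fq : w fp fq = 0; w_z_fq : w z fq = 0 }.

Lemma darboux_values p t q fp z fq : darboux p t q fp z fq ->
  ((w p p = 0) * (w p t = 0) * (w p q = 0) * (w p fp = 1) * (w p z = 0) * (w p fq = 0) *
   (w t p = 0) * (w t t = 0) * (w t q = 0) * (w t fp = 0) * (w t z = 1) * (w t fq = 0) *
   (w q p = 0) * (w q t = 0) * (w q q = 0) * (w q fp = 0) * (w q z = 0) * (w q fq = 1) *
   (w fp p = -1) * (w fp t = 0) * (w fp q = 0) * (w fp fp = 0) * (w fp z = 0) * (w fp fq = 0) *
   (w z p = 0) * (w z t = -1) * (w z q = 0) * (w z fp = 0) * (w z z = 0) * (w z fq = 0) *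
   (w fq p = 0) * (w fq t = 0) * (w fq q = -1) * (w fq fp = 0) * (w fq z = 0) * (w fq fq = 0))%type.
Proof.
have C X Y a : w X Y = a -> w Y X = - a by move=> <-; exact: omegaC.
have C0 X Y : w X Y = 0 -> w Y X = 0 by move=> /C ->; rewrite oppr0.
by case=> *; do ![split]; rewrite ?(omegaxx w) //; first [exact: C | exact: C0].
Qed.

Lemma darboux_expand p t q fp z fq : darboux p t q fp z fq -> forall X,
  X = w X fp *: p + w X z *: t + w X fq *: q
      - w X p *: fp - w X t *: z - w X q *: fq.
Proof.
move=> D; have E := darboux_values D.
have bas : basis_of {:V} [tuple p; t; q; fp; z; fq].
  rewrite basisEfree subvf dim6 /= andbT; change (free [tuple p; t; q; fp; z; fq]).
  apply/freeP => c.
  rewrite !big_ord_recl big_ord0 /= addr0 => c0.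
  have pair X := congr1 (fun v => w v X) c0.
  have c1 := pair fp; have c2 := pair z; have c3 := pair fq.
  have c4 := pair p; have c5 := pair t; have c6 := pair q.
  move: c1 c2 c3 c4 c5 c6.
  rewrite !(linearDl, linearZl_LR, linear0l) /= !E !mulr0 !mulr1 !mulrN1 !addr0 !add0r.
  move=> c1 c2 c3 /eqP; rewrite oppr_eq0 => /eqP c4 /eqP; rewrite oppr_eq0 => /eqP c5.
  move=> /eqP; rewrite oppr_eq0 => /eqP c6.
  by case=> [[|[|[|[|[|[|//]]]]]] i6];
    [rewrite -[RHS]c1|rewrite -[RHS]c2|rewrite -[RHS]c3
    |rewrite -[RHS]c4|rewrite -[RHS]c5|rewrite -[RHS]c6]; congr c; apply: val_inj.
move=> X; apply: (omega_inj symp) => Y.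
rewrite (coord_basis bas (memvf Y)) !linear_sumr; apply: eq_bigr => i _.
rewrite linearZr_LR [RHS]linearZr_LR; congr (_ * _).
case: i => [[|[|[|[|[|[|//]]]]]] i6] /=; rewrite !(linearDl, linearNl, linearZl_LR) /= !E; ring.
Qed.

(* The span of fp, z, fq is a Lagrangian ideal that contains [V,V] and meets the
   center in the span of fp and fq; the symmetric form w [z,.] . is diagonal. *)
Record adapted (p t q fp z fq : V) (b1 b2 : R) : Prop := Adapted {
  adapted_darboux : darboux p t q fp z fq;
  br_fp : forall X Y, w (br X Y) fp = 0;
  br_z : forall X Y, w (br X Y) z = 0;
  br_fq : forall X Y, w (br X Y) fq = 0;
  fp_central : central br fp;
  fq_central : central br fq;
  T_z : forall Y Z, T z Y Z = b1 * w Y fp * w Z fp + b2 * w Y fq * w Z fq;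
  b1_neq0 : b1 != 0 }.

(** The trilinear form [omega (br X Y) Z] in an adapted basis: [x1], [x2], [x3] are the coordinates
    of X on [p], [t], [q], and [xt] is minus its coordinate on [z]. *)
Definition tensor_form (ptp ptt ptq pqp pqt pqq tqp tqq b1 b2
    x1 x2 x3 xt y1 y2 y3 yt z1 z2 z3 : R) : R :=
  (x1 * y2 - x2 * y1) * (ptp * z1 + ptt * z2 + ptq * z3)
  + (x1 * y3 - x3 * y1) * (pqp * z1 + pqt * z2 + pqq * z3)
  + (x2 * y3 - x3 * y2) * (tqp * z1 + tqq * z3)
  - xt * (b1 * y1 * z1 + b2 * y3 * z3)
  + yt * (b1 * x1 * z1 + b2 * x3 * z3).

Lemma tensor_form_scale k l1 l2 l3 i2 ptp ptt ptq pqp pqt pqq tqp tqq b1 b2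
    x1 x2 x3 xt y1 y2 y3 yt z1 z2 z3 :
  k * tensor_form ptp ptt ptq pqp pqt pqq tqp tqq b1 b2
    (l1 * x1) (l2 * x2) (l3 * x3) (i2 * xt) (l1 * y1) (l2 * y2) (l3 * y3) (i2 * yt)
    (l1 * z1) (l2 * z2) (l3 * z3) =
  tensor_form (k * l1 * l2 * l1 * ptp) (k * l1 * l2 * l2 * ptt) (k * l1 * l2 * l3 * ptq)
    (k * l1 * l3 * l1 * pqp) (k * l1 * l3 * l2 * pqt) (k * l1 * l3 * l3 * pqq)
    (k * l2 * l3 * l1 * tqp) (k * l2 * l3 * l3 * tqq)
    (k * i2 * l1 * l1 * b1) (k * i2 * l3 * l3 * b2)
    x1 x2 x3 xt y1 y2 y3 yt z1 z2 z3.
Proof. rewrite /tensor_form; ring. Qed.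

Section Tensor.
Variables (p t q fp z fq : V) (b1 b2 : R).
Hypothesis ad : adapted p t q fp z fq b1 b2.

Let D := adapted_darboux ad.
Let E := darboux_values D.

(** The conditions place [A] in the Lagrangian span of [fp], [z], [fq], whose members [fp] and [fq]
    are central. *)
Lemma br_ideal A X Y : w A fp = 0 -> w A z = 0 -> w A fq = 0 ->
  T A X Y = - w A t * T z X Y.
Proof.
move=> A1 A2 A3; rewrite {1}(darboux_expand D A) A1 A2 A3 !scale0r !add0r.
rewrite !linearDl !linearNl !linearZl_LR /= (fp_central ad) (fq_central ad).
by rewrite !linear0l; ring.
Qed.

Lemma T_br X Y Z W : T (br X Y) Z W = - T X Y t * T z Z W.
Proof. by rewrite br_ideal ?(br_fp ad) ?(br_z ad) ?(br_fq ad). Qed.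

Lemma T_cyclic X Y Z : T X Y Z + T Y Z X + T Z X Y = 0.
Proof. exact: symp.2. Qed.

Lemma T_skew X Y Z : T Y X Z = - T X Y Z.
Proof. by rewrite (brC lie X Y) linearNl. Qed.

(** In the Jacobi identity for [p], [q], [t] paired with [p], only [b1 * T q t t] survives up to
    sign, the form w [z,.] . being diagonal. Pairing with [q] gives [T_ptt]. *)
Lemma T_qtt : T q t t = 0.
Proof.
have := congr1 (fun X => w X p) (jacobi lie p q t).
rewrite !linearDl linear0l /= !T_br !(T_z ad) !E !(mulr0, mul0r, mulr1, addr0, add0r).
by rewrite mulNr => /eqP; rewrite oppr_eq0 mulf_eq0 (negPf (b1_neq0 ad)) orbF => /eqP.
Qed.

Lemma T_ptt : b2 * T p t t = 0.
Proof.
have := congr1 (fun X => w X q) (jacobi lie p q t).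
rewrite !linearDl linear0l /= !T_br !(T_z ad) !E !(mulr0, mul0r, mulr1, addr0, add0r).
by rewrite (T_skew p t) opprK mulrC.
Qed.

Lemma T_tqp : T t q p = T p q t - T p t q.
Proof. by have := T_cyclic p t q; rewrite (T_skew p q); lra. Qed.

(* The five groups of terms come from the pairs (p,t), (p,q), (t,q) and from the
   z-components - w X t and - w Y t; the coefficient of T t q t is 0 by T_qtt. *)
Lemma tensorE X Y Z : T X Y Z =
  tensor_form (T p t p) (T p t t) (T p t q) (T p q p) (T p q t) (T p q q) (T t q p)
    (T t q q) b1 b2 (w X fp) (w X z) (w X fq) (w X t) (w Y fp) (w Y z) (w Y fq) (w Y t)
    (w Z fp) (w Z z) (w Z fq).
Proof.
rewrite /tensor_form.
set x1 := w X fp; set x2 := w X z; set x3 := w X fq.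
set y1 := w Y fp; set y2 := w Y z; set y3 := w Y fq.
set z1 := w Z fp; set z2 := w Z z; set z3 := w Z fq.
pose A := - w X p *: fp + - w X t *: z + - w X q *: fq.
pose B := - w Y p *: fp + - w Y t *: z + - w Y q *: fq.
have XE : X = (x1 *: p + x2 *: t + x3 *: q) + A.
  by rewrite {1}(darboux_expand D X) /A !scaleNr !addrA.
have YE : Y = (y1 *: p + y2 *: t + y3 *: q) + B.
  by rewrite {1}(darboux_expand D Y) /B !scaleNr !addrA.
have Aa : [/\ w A fp = 0, w A z = 0, w A fq = 0 & w A t = w X t].
  by rewrite /A !linearDl !linearZl_LR /= !E; split; ring.
have Ba : [/\ w B fp = 0, w B z = 0, w B fq = 0 & w B t = w Y t].
  by rewrite /B !linearDl !linearZl_LR /= !E; split; ring.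
have [A1 A2 A3 A4] := Aa; have [B1 B2 B3 B4] := Ba.
have TA U W : T A U W = - w X t * (b1 * w U fp * w W fp + b2 * w U fq * w W fq).
  by rewrite br_ideal // A4 (T_z ad).
have TB U W : T B U W = - w Y t * (b1 * w U fp * w W fp + b2 * w U fq * w W fq).
  by rewrite br_ideal // B4 (T_z ad).
have ZE : Z = (z1 *: p + z2 *: t + z3 *: q)
    + (- w Z p *: fp + - w Z t *: z + - w Z q *: fq).
  by rewrite {1}(darboux_expand D Z) !scaleNr !addrA.
have Ta U W : T U W Z = z1 * T U W p + z2 * T U W t + z3 * T U W q.
  rewrite {1}ZE !linearDr !linearZr_LR /= (br_fp ad) (br_z ad) (br_fq ad); ring.
have X0B : T (x1 *: p + x2 *: t + x3 *: q) Y Z =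
    T (x1 *: p + x2 *: t + x3 *: q) (y1 *: p + y2 *: t + y3 *: q) Z
    - T B (x1 *: p + x2 *: t + x3 *: q) Z.
  rewrite [in LHS]YE (linearDr br) linearDl; congr (_ + _).
  exact: T_skew.
transitivity (T (x1 *: p + x2 *: t + x3 *: q) Y Z + T A Y Z).
  by rewrite [in LHS]XE (linearDl br) linearDl.
rewrite X0B TA TB -/y1 -/y3 -/z1 -/z3.
have -> : w (x1 *: p + x2 *: t + x3 *: q) fp = x1.
  rewrite !linearDl !linearZl_LR /= !E; ring.
have -> : w (x1 *: p + x2 *: t + x3 *: q) fq = x3.
  rewrite !linearDl !linearZl_LR /= !E; ring.
rewrite Ta !(linearDl, linearDr, linearZl_LR, linearZr_LR) /= !(brxx lie) !linear0l.
rewrite (T_skew p t p) (T_skew p t t) (T_skew p t q) (T_skew p q p) (T_skew p q t).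
rewrite (T_skew p q q) (T_skew t q p) (T_skew t q t) (T_skew t q q).
have -> : T t q t = 0 by rewrite (T_skew q t) T_qtt oppr0.
ring.
Qed.
End Tensor.
End Adapted.

(** * Symplectic dilations of the bracket *)

Section Dilation.
Variables (R : realType) (V : vectType R) (br : {bilinear V -> V -> V}).
Variable omega : {skew_symmetric V}.
Hypothesis lie : lie_bracket br.
Hypothesis symp : symplectic br omega.
Hypothesis dim6 : \dim {:V} = 6%N.
Implicit Types X Y Z U W A B : V.

Local Notation w := omega.
Local Notation T X Y Z := (omega (br X Y) Z).

Section Change.
Variables (p t q fp z fq : V) (b1 b2 : R).
Hypothesis ad : adapted br omega p t q fp z fq b1 b2.
Let E := darboux_values (adapted_darboux ad).

(** The added coefficients form a symmetric matrix, which keeps [p], [t], [q] mutually orthogonal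
    for [omega]. *)
Lemma adapted_shear s m r : adapted br omega
  (p + s *: z) (t + s *: fp + m *: z + r *: fq) (q + r *: z) fp z fq b1 b2.
Proof.
case: (ad) => _ *; split=> //; split;
  rewrite ?(linearDl, linearDr, linearZl_LR, linearZr_LR) /= ?E; ring.
Qed.

(** When [b2] is 0 the form w [z,.] . involves only [fp], which is fixed here; [z] moves by a
    central vector to restore the pairings. *)
Lemma adapted_shift_q e : b2 = 0 ->
  adapted br omega p t (q + e *: t) fp (z - e *: fq) fq b1 b2.
Proof.
move=> b20; case: (ad) => _ a1 a2 a3 c1 c2 Tz b10; split=> //.
- split; rewrite ?(linearDl, linearDr, linearNr, linearNl, linearZl_LR, linearZr_LR) /= ?E; ring.
- by move=> X Y; rewrite linearBr linearZr_LR /= a2 a3 mulr0 subr0.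
- move=> Y Z; rewrite (linearBl br) (linearZl_LR br) /= c2 scaler0 subr0 Tz b20; ring.
Qed.

Lemma adapted_shift_p b c : b2 = 0 ->
  adapted br omega (p + b *: t + c *: q) t q fp (z - b *: fp) (fq - c *: fp) b1 b2.
Proof.
move=> b20; case: (ad) => _ a1 a2 a3 c1 c2 Tz b10; split=> //.
- split; rewrite ?(linearDl, linearDr, linearNr, linearNl, linearZl_LR, linearZr_LR) /= ?E; ring.
- by move=> X Y; rewrite linearBr linearZr_LR /= a2 a1 mulr0 subr0.
- by move=> X Y; rewrite linearBr linearZr_LR /= a3 a1 mulr0 subr0.
- by move=> X; rewrite linearBl linearZl_LR c1 c2 scaler0 subr0.
- move=> Y Z; rewrite (linearBl br) (linearZl_LR br) /= c1 scaler0 subr0 Tz b20; ring.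
Qed.

(** The diagonal map with entries l1, l2, l3 on [p], [t], [q] and their inverses on [fp], [z], [fq];
    the signs are those of [darboux_expand]. *)
Definition darboux_diag (l1 l2 l3 : R) : 'End(V) := linfun (fun X =>
  (l1 * w X fp) *: p + (l2 * w X z) *: t + (l3 * w X fq) *: q
  + (- l1^-1 * w X p) *: fp + (- l2^-1 * w X t) *: z + (- l3^-1 * w X q) *: fq).

Lemma darboux_diagE l1 l2 l3 X : darboux_diag l1 l2 l3 X =
  (l1 * w X fp) *: p + (l2 * w X z) *: t + (l3 * w X fq) *: q
  + (- l1^-1 * w X p) *: fp + (- l2^-1 * w X t) *: z + (- l3^-1 * w X q) *: fq.
Proof.
pose F X := (l1 * w X fp) *: p + (l2 * w X z) *: t + (l3 * w X fq) *: q
  + (- l1^-1 * w X p) *: fp + (- l2^-1 * w X t) *: z + (- l3^-1 * w X q) *: fq.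
have L : linear F.
  move=> c Y Z; apply: (omega_inj symp) => U.
  rewrite /F !(linearDl, linearZl_LR) /=; ring.
pose f : {linear V -> V} := HB.pack F (GRing.isLinear.Build R V V _ _ L).
exact: (lfunE f).
Qed.

Lemma omega_darboux_diag l1 l2 l3 X :
  [/\ w (darboux_diag l1 l2 l3 X) fp = l1 * w X fp, w (darboux_diag l1 l2 l3 X) z = l2 * w X z,
      w (darboux_diag l1 l2 l3 X) fq = l3 * w X fq
    & [/\ w (darboux_diag l1 l2 l3 X) p = l1^-1 * w X p,
           w (darboux_diag l1 l2 l3 X) t = l2^-1 * w X t
        & w (darboux_diag l1 l2 l3 X) q = l3^-1 * w X q]].
Proof.
rewrite darboux_diagE; do ![split]; rewrite !(linearDl, linearZl_LR) /= !E; ring.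
Qed.

Lemma darboux_diagK l1 l2 l3 : l1 != 0 -> l2 != 0 -> l3 != 0 ->
  cancel (darboux_diag l1 l2 l3) (darboux_diag l1^-1 l2^-1 l3^-1).
Proof.
move=> l10 l20 l30 X; have [e1 e2 e3 [e4 e5 e6]] := omega_darboux_diag l1 l2 l3 X.
rewrite darboux_diagE e1 e2 e3 e4 e5 e6 [RHS](darboux_expand symp dim6 (adapted_darboux ad)).
rewrite !invrK !mulrA !mulVf // !mulNr !mulfV // !mul1r.
by rewrite !scaleNr.
Qed.

Lemma darboux_diag_symplectic l1 l2 l3 : l1 != 0 -> l2 != 0 -> l3 != 0 ->
  symplectomorphism omega (darboux_diag l1 l2 l3) (darboux_diag l1^-1 l2^-1 l3^-1).
Proof.
move=> l10 l20 l30; split; first exact: darboux_diagK.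
  by rewrite -{2}(invrK l1) -{2}(invrK l2) -{2}(invrK l3); apply: darboux_diagK; rewrite invr_eq0.
move=> X Y; have [e1 e2 e3 [e4 e5 e6]] := omega_darboux_diag l1 l2 l3 X.
rewrite (darboux_diagE l1 l2 l3 Y) !linearDr !linearZr_LR /= e1 e2 e3 e4 e5 e6.
rewrite [in RHS](darboux_expand symp dim6 (adapted_darboux ad) Y).
rewrite !linearDr !linearNr !linearZr_LR /=; field.
by rewrite l10 l20 l30.
Qed.

(** Tested against [psi Z], the identity reads T X Y Z = kappa T (psi X) (psi Y) (psi Z), which
    holds once each component scales correctly. *)
Lemma dilation_diag kappa l1 l2 l3 : l1 != 0 -> l2 != 0 -> l3 != 0 ->
  kappa * l1 * l2 * l1 * T p t p = T p t p ->
  kappa * l1 * l2 * l2 * T p t t = T p t t ->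
  kappa * l1 * l2 * l3 * T p t q = T p t q ->
  kappa * l1 * l3 * l1 * T p q p = T p q p ->
  kappa * l1 * l3 * l2 * T p q t = T p q t ->
  kappa * l1 * l3 * l3 * T p q q = T p q q ->
  kappa * l2 * l3 * l1 * T t q p = T t q p ->
  kappa * l2 * l3 * l3 * T t q q = T t q q ->
  kappa * l2^-1 * l1 * l1 = 1 -> kappa * l2^-1 * l3 * l3 * b2 = b2 ->
  exists psi psi', symplectomorphism omega psi psi' /\
    forall X Y, psi (br X Y) = kappa *: br (psi X) (psi Y).
Proof.
move=> l10 l20 l30 ptp ptt ptq pqp pqt pqq tqp tqq hb1 hb2.
exists (darboux_diag l1 l2 l3), (darboux_diag l1^-1 l2^-1 l3^-1).
have S := darboux_diag_symplectic l10 l20 l30.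
split=> // X Y; apply: (omega_inj symp) => Z'.
have [_ psi'K psiw] := S; rewrite -(psi'K Z'); move: (darboux_diag l1^-1 l2^-1 l3^-1 Z') => Z.
have TE := tensorE lie symp dim6 ad.
rewrite psiw linearZl_LR /= (TE X Y Z).
rewrite (TE (darboux_diag _ _ _ X) (darboux_diag _ _ _ Y) (darboux_diag _ _ _ Z)).
have [-> -> -> [_ -> _]] := omega_darboux_diag l1 l2 l3 X.
have [-> -> -> [_ -> _]] := omega_darboux_diag l1 l2 l3 Y.
have [-> -> -> _] := omega_darboux_diag l1 l2 l3 Z.
by rewrite tensor_form_scale ptp ptt ptq pqp pqt pqq tqp tqq hb1 hb2 mul1r.
Qed.

End Change.
End Dilation.

Lemma root_exists (R : realType) (k : nat) (a : R) :
  0 < a -> exists2 t, 0 < t & t ^+ k.+1 = a.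
Proof.
move=> a0; have [||t /andP[t0 _]] := @poly_ivt R ('X^(k.+1) - a%:P) 0 (1 + a).
- by rewrite addr_ge0 ?ler01 ?ltW.
- rewrite !hornerE expr0n /= sub0r oppr_le0 ltW //= subr_ge0.
  have k1 : 1 <= (1 + a) ^+ k by rewrite exprn_ege1 // lerDl ltW.
  rewrite exprS (le_trans (y := (1 + a) * 1)) ?mulr1 ?lerDr // ler_peMr //.
  by rewrite addr_ge0 ?ler01 ?ltW.
rewrite /root !hornerE subr_eq0 => /eqP ta; exists t => //.
by rewrite lt_def t0 andbT; apply: contraTneq a0 => t00; rewrite -ta t00 expr0n ltxx.
Qed.

Section Dilation.
Variables (R : realType) (V : vectType R) (br : {bilinear V -> V -> V}).
Variable omega : {skew_symmetric V}.
Hypothesis lie : lie_bracket br.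
Hypothesis symp : symplectic br omega.
Hypothesis dim6 : \dim {:V} = 6%N.

Local Notation w := omega.
Local Notation T X Y Z := (omega (br X Y) Z).

Section Tensor.
Variables (p t q fp z fq : V) (b1 b2 : R).
Hypothesis ad : adapted br omega p t q fp z fq b1 b2.
Let E := darboux_values (adapted_darboux ad).
Let TE := tensorE lie symp dim6 ad.

Lemma tensor_shear s m r :
  let p1 := p + s *: z in let t1 := t + s *: fp + m *: z + r *: fq in let q1 := q + r *: z in
  [/\ T p1 t1 p1 = T p t p - m * b1, T p1 t1 t1 = T p t t, T p1 t1 q1 = T p t q,
      T p1 q1 p1 = T p q p - r * b1
    & [/\ T p1 q1 t1 = T p q t, T p1 q1 q1 = T p q q + s * b2,
      T t1 q1 p1 = T t q p & T t1 q1 q1 = T t q q + m * b2]].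
Proof.
move=> p1 t1 q1.
rewrite (TE p1 t1 p1) (TE p1 t1 t1) (TE p1 t1 q1) (TE p1 q1 p1) (TE p1 q1 t1).
rewrite (TE p1 q1 q1) (TE t1 q1 p1) (TE t1 q1 q1) /p1 /t1 /q1 /tensor_form.
rewrite !(linearDl, linearZl_LR) /= !E; do ![split]; ring.
Qed.

Lemma tensor_shift_p b c : let p1 := p + b *: t + c *: q in
  [/\ T p1 t t = T p t t, T p1 q t = T p q t, T p1 q q = T p q q + b * T t q q
    & T t q p1 = T t q p + c * T t q q].
Proof.
move=> p1; rewrite (TE p1 t t) (TE p1 q t) (TE p1 q q) (TE t q p1) /p1 /tensor_form.
rewrite !(linearDl, linearZl_LR) /= !E; do ![split]; ring.
Qed.

Lemma tensor_shift_q e : let q1 := q + e *: t in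
  T p q1 t = T p q t + e * T p t t /\ T t q1 q1 = T t q q.
Proof.
move=> q1; rewrite (TE p q1 t) (TE t q1 q1) /q1 /tensor_form.
rewrite !(linearDl, linearZl_LR) /= !E; do ![split]; ring.
Qed.
End Tensor.

(* In each case a change of adapted basis kills the components of the bracket
   that are not homogeneous for weights d1, d2, d3 of p, t, q, the weights of
   fp, z, fq being N - d1, N - d2, N - d3: a component T e_i e_j e_k survives only
   if d_i + d_j + d_k = N. The weights are (1,2,1) with N = 4, (1,2,2) with N = 5
   and (2,4,3) with N = 10. *)
Lemma adapted_dilation p t q fp z fq b1 b2 : adapted br omega p t q fp z fq b1 b2 ->
  forall kappa, 0 < kappa -> exists psi psi', symplectomorphism omega psi psi' /\
    forall X Y, psi (br X Y) = kappa *: br (psi X) (psi Y).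
Proof.
move=> ad kappa k0.
(* Weights d_i with total N act by l_i = r^(d_i - N/2), with kappa = r^(N/2). Here r is [s] for
   (1,2,1), u^2 for (1,2,2) and [u] for (2,4,3), where s^2 = u^5 = kappa. *)
have [s s0 s2] := root_exists 1 k0; have [u u0 u5] := root_exists 4 k0.
have sn0 : s != 0 by rewrite gt_eqF. have un0 : u != 0 by rewrite gt_eqF.
have weights121 p' t' q' fp' z' fq' b1' b2' : adapted br omega p' t' q' fp' z' fq' b1' b2' ->
    T p' t' t' = 0 -> T p' q' p' = 0 -> T p' q' q' = 0 ->
    exists psi psi', symplectomorphism omega psi psi' /\
    forall X Y, psi (br X Y) = kappa *: br (psi X) (psi Y).
  move=> ad' ptt pqp pqq.
  apply: (@dilation_diag _ _ _ _ lie symp dim6 _ _ _ _ _ _ _ _ ad' kappa s^-1 1 s^-1);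
    rewrite ?invr_eq0 ?oner_eq0 ?ptt ?pqp ?pqq ?mulr0 // -s2 ?invr1 ?mulr1; by field.
have [b20|b2n0] := eqVneq b2 0; last first.
  (* With [b2] nonzero the remaining obstructions to the weights (1,2,1) are T p q q and T p q p,
     cancelled by a shear. *)
  have ptt : T p t t = 0.
    by apply/eqP; have /eqP := T_ptt lie symp dim6 ad; rewrite mulf_eq0 (negPf b2n0).
  have b1n0 := b1_neq0 ad.
  have := tensor_shear ad (- T p q q / b2) 0 (T p q p / b1).
  have := adapted_shear ad (- T p q q / b2) 0 (T p q p / b1).
  set p1 := p + _; set t1 := t + _ + _ + _; set q1 := q + _ => ad1 /=.
  rewrite ptt => -[_ ptt1 _ pqp1 [_ pqq1 _ _]].
  by apply: (weights121 _ _ _ _ _ _ _ _ ad1); rewrite // ?pqp1 ?pqq1; field.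
rewrite {b2}b20 in ad.
(* With [b2] = 0 a shear cancels T p t p and T p q p; the three cases then fit the weights (1,2,2),
   (1,2,1) and (2,4,3). *)
have normalized p' t' q' fp' z' fq' b1' : adapted br omega p' t' q' fp' z' fq' b1' 0 ->
    [\/ T t' q' q' = 0,
        T p' t' t' = 0 /\ T p' q' q' = 0 |
        [/\ T p' q' t' = 0, T p' q' q' = 0 & T t' q' p' = 0]] ->
    exists psi psi', symplectomorphism omega psi psi' /\
    forall X Y, psi (br X Y) = kappa *: br (psi X) (psi Y).
  move=> ad'; have b1n0 := b1_neq0 ad'.
  have := tensor_shear ad' 0 (T p' t' p' / b1') (T p' q' p' / b1').
  have := adapted_shear ad' 0 (T p' t' p' / b1') (T p' q' p' / b1').
  rewrite divfK // divfK // !subrr !mulr0 !addr0.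
  set p1 := p' + _; set t1 := t' + _ + _ + _; set q1 := q' + _ => ad1 /=.
  move=> [ptp1 ptt1 ptq1 pqp1 [pqt1 pqq1 tqp1 tqq1]] cases.
  have ptq_cyc := T_tqp lie symp p1 t1 q1.
  case: cases => [tqq|[ptt pqq]|[pqt pqq tqp]].
  - apply: (@dilation_diag _ _ _ _ lie symp dim6 _ _ _ _ _ _ _ _ ad1 kappa (u ^- 3) u^-1 u^-1);
      rewrite ?invr_eq0 ?expf_neq0 ?ptp1 ?pqp1 ?tqq1 ?tqq ?mulr0 // -u5; by field.
  - by apply: (weights121 _ _ _ _ _ _ _ _ ad1); rewrite ?ptt1 ?pqp1 ?pqq1.
  have ptq : T p1 t1 q1 = 0 by move: ptq_cyc; rewrite tqp1 tqp pqt1 pqt; lra.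
  apply: (@dilation_diag _ _ _ _ lie symp dim6 _ _ _ _ _ _ _ _ ad1 kappa (u ^- 3) u^-1 (u ^- 2));
    rewrite ?invr_eq0 ?expf_neq0 ?ptp1 ?pqp1 ?ptq ?pqt1 ?pqt ?pqq1 ?pqq ?tqp1 ?tqp ?mulr0 // -u5;
    by field.
have [tqq|n0] := eqVneq (T t q q) 0; first by apply: (normalized _ _ _ _ _ _ _ ad); constructor 1.
have [ptt|k_neq0] := eqVneq (T p t t) 0.
  have [ptt1 _ pqq1 _] := tensor_shift_p ad (- T p q q / T t q q) 0.
  apply: (normalized _ _ _ _ _ _ _ (adapted_shift_p ad (- T p q q / T t q q) 0 erefl)).
  by constructor 2; rewrite ptt1 pqq1 ptt; split=> //; field.
(* Now T t q q and T p t t are both nonzero: adding a multiple of [t] to [q] cancels T p q t, then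
   adding multiples of [t] and [q] to [p] cancels T p q q and T t q p. *)
have ad1 := adapted_shift_q ad (- T p q t / T p t t) erefl.
have [pqt1 tqq1] := tensor_shift_q ad (- T p q t / T p t t).
move: ad1 pqt1 tqq1; set q1 := q + _; set z1 := z - _ => ad1 pqt1 tqq1.
have ad2 := adapted_shift_p ad1 (- T p q1 q1 / T t q1 q1) (- T t q1 p / T t q1 q1) erefl.
have [_ pqt2 pqq2 tqp2] := tensor_shift_p ad1 (- T p q1 q1 / T t q1 q1) (- T t q1 p / T t q1 q1).
apply: (normalized _ _ _ _ _ _ _ ad2); constructor 3.
rewrite pqt2 pqq2 tqp2 pqt1 tqq1; split; by field.
Qed.

End Dilation.

(** * Existence of adapted bases, and the Chern-Ricci operator in them *)

Section Existence.
Variables (R : realType) (V : vectType R) (br : {bilinear V -> V -> V}).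
Variable omega : {skew_symmetric V}.
Hypothesis lie : lie_bracket br.
Hypothesis nil3 : lower_central br 3 = 0%VS.
Hypothesis symp : symplectic br omega.
Hypothesis dim6 : \dim {:V} = 6%N.
Implicit Types X Y Z U W A B : V.

Local Notation w := omega.
Local Notation T X Y Z := (omega (br X Y) Z).

(** [theta] sees only the [z] component of a bracket, so [P] maps into the Lagrangian ideal. The
    defect of the derivation rule is then a multiple of [b2 * T p t t], zero by [T_ptt]. *)
Lemma adapted_derivation p t q fp z fq b1 b2 (theta : V -> R) (P : 'End(V)) :
  adapted br omega p t q fp z fq b1 b2 ->
  linear (theta : V -> R^o) -> (forall Z, central br Z -> theta Z = 0) ->
  (forall X Y, w (P X) Y = theta (br X Y)) -> derivation br P.
Proof.
move=> ad theta_lin theta0 PE; have E := darboux_values (adapted_darboux ad).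
have TE := tensorE lie symp dim6 ad.
have thZ a A B : theta (a *: A + B) = a * theta A + theta B by exact: theta_lin.
have PT X Y : w (P X) Y = - theta z * T X Y t.
  rewrite PE [br X Y](darboux_expand symp dim6 (adapted_darboux ad)).
  rewrite (br_fp ad) (br_z ad) (br_fq ad) !scale0r !add0r -!scaleNr -addrA thZ thZ.
  rewrite (theta0 _ (fp_central ad)) (theta0 _ (centralZ _ (fq_central ad))).
  rewrite !(linearDl, linearNl, linearZl_LR) /= !E; ring.
have PX X : [/\ w (P X) fp = 0, w (P X) z = 0 & w (P X) fq = 0].
  rewrite !PT (br_central_r lie X (fp_central ad)) (br_central_r lie X (fq_central ad)).
  rewrite (T_skew w lie z X) (T_z ad) !E linear0l; split; ring.
have TP X Y Z : T (P X) Y Z = theta z * T X t t * T z Y Z.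
  have [P1 P2 P3] := PX X; rewrite (br_ideal symp dim6 ad) // PT; ring.
move=> X Y; apply: (omega_inj symp) => Z.
rewrite linearDl /= (T_skew w lie (P Y)) !TP PT (T_br symp dim6 ad) !(T_z ad) !E.
rewrite (TE X t t) (TE Y t t) /tensor_form !E.
have := T_ptt lie symp dim6 ad => ptt.
apply/eqP; rewrite -subr_eq0; apply/eqP.
transitivity (theta z * w Z fq * (w Y fp * w X fq - w X fp * w Y fq) * (b2 * T p t t));
  last by rewrite ptt mulr0.
ring.
Qed.

(** [u] is the left-symmetric product Y.Z of the symplectic Lie algebra, given by omega(Y.Z, U) = -
    omega(Z, [Y,U]). *)
Lemma flat_product_exists Y Z : exists u, forall U, w U u = T U Y Z.
Proof.
pose h A B : R := - w (br B Y) A.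
exists (operator_of w h Z) => U; rewrite (omegaC w).
rewrite -(operator_ofP symp.1) => [|]; first by rewrite /h opprK.
split=> [B a A A'|A a B B']; rewrite /h; first by rewrite linearPr /=; ring.
by rewrite linearPl linearPl /=; ring.
Qed.

(** From [x] with w [z,x] x nonzero, [fp] is a multiple of [z,x], [t] a multiple of the flat square
    of [x], and [p] corrects [x] to be orthogonal to [z] and [t]. The pair [q], [fq] comes from the
    symplectic complement. *)
Lemma adapted_exists : lower_central br 2 <> 0%VS ->
  exists p t q fp z fq b1 b2, adapted br omega p t q fp z fq b1 b2.
Proof.
move=> c2; have [X0 [Y0 []]] := derived_generator lie nil3 symp dim6 c2.
set z := br X0 Y0 => z_nc genz.
have C := omegaC w.
have wc := omega_central lie symp.
have br3 := br3_central lie nil3.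
(* Brackets are multiples of [z] modulo the center, and central vectors are orthogonal to [V,V]; so
   [V,V] is isotropic. *)
have iso X Y Z W : w (br X Y) (br Z W) = 0.
  have [[r rc] [s sc]] := (genz X Y, genz Z W).
  have -> : br X Y = (br X Y - r *: z) + r *: z by rewrite subrK.
  rewrite linearDl /= [X in X + _]C wc // oppr0 add0r linearZl_LR /=.
  have -> : br Z W = (br Z W - s *: z) + s *: z by rewrite subrK.
  by rewrite linearDr linearZr_LR /= [X in _ * (X + _)]C C wc // (omegaxx w) !(oppr0, mulr0, addr0).
have zsym X Y : T z X Y = T z Y X.
  have := symp.2 z X Y; rewrite (brC lie z Y) linearNl iso addr0 /=.
  by move=> /eqP; rewrite subr_eq0 => /eqP.
have [x x_neq0] : exists x, T z x x != 0.
  apply: contrapT => H; apply: z_nc => X; apply: (omega_nd symp) => Y.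
  have zq U : T z U U = 0 by apply/eqP/negPn/negP => U0; apply: H; exists U.
  have := zq (X + Y); rewrite !(linearDl, linearDr) /= !zq (zsym Y X); lra.
set b := T z x x in x_neq0.
have Tc A Y Z : central br A -> T A Y Z = 0 by move=> A0; rewrite A0 linear0l.
have genE X Y : central br (br X Y - (T (br X Y) x x / b) *: z).
  have [r rc] := genz X Y; suff -> : T (br X Y) x x / b = r by [].
  have := Tc _ x x rc; rewrite !(linearBl, linearZl_LR) /= -/b => /eqP.
  by rewrite subr_eq0 => /eqP ->; rewrite mulfK.
have brE X Y Z : br (br X Y) Z = (T (br X Y) x x / b) *: br z Z.
  apply/eqP; rewrite -subr_eq0; apply/eqP; rewrite -[RHS](genE X Y Z).
  by rewrite linearBl linearZl_LR.
have [t0 t0E] := flat_product_exists x x; have [w0 w0E] := flat_product_exists x t0.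
have [t t_def] : exists t, t = - b^-1 *: t0 by eexists.
have [fp fp_def] : exists fp, fp = - b^-1 *: br z x by eexists.
have [p p_def] : exists p, p = x + - w x z *: t + w x t *: z by eexists.
have t_z : w t z = 1 by rewrite t_def linearZl_LR /= C t0E -/b mulrNN mulVf.
have t_fp : w t fp = 0.
  by rewrite t_def fp_def linearZl_LR linearZr_LR /= C t0E Tc ?oppr0 ?mulr0 //; apply: br3.
have fp_z : w fp z = 0 by rewrite fp_def linearZl_LR /= iso mulr0.
have x_fp : w x fp = 1 by rewrite fp_def linearZr_LR /= C -/b mulrNN mulVf.
have z_t : w z t = -1 by rewrite C t_z.
have z_fp : w z fp = 0 by rewrite C fp_z oppr0.
have p_fp : w p fp = 1.
  by rewrite p_def !linearDl !linearZl_LR /= x_fp t_fp z_fp !mulr0 !addr0.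
have p_z : w p z = 0.
  by rewrite p_def !linearDl !linearZl_LR /= t_z (omegaxx w) mulr1 mulr0 addr0 subrr.
have p_t : w p t = 0.
  by rewrite p_def !linearDl !linearZl_LR /= (omegaxx w) z_t mulr0 addr0 mulrN1 subrr.
have fp_c : central br fp by rewrite fp_def; apply/centralZ/br3.
(* Projection onto the symplectic complement of the span of [p], [t], [fp], [z]. *)
pose pr U := U - w U fp *: p - w U z *: t + w U p *: fp + w U t *: z.
have wpr U W : w (pr U) W = w U W - w U fp * w p W - w U z * w t W
    + w U p * w fp W + w U t * w z W.
  by rewrite /pr !(linearDl, linearNl, linearZl_LR).
have hyp := (p_fp, p_z, p_t, t_z, t_fp, fp_z, z_t, z_fp, omegaxx w).
have prH U : [/\ w (pr U) p = 0, w (pr U) t = 0, w (pr U) fp = 0 & w (pr U) z = 0].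
  rewrite !wpr !hyp (C p t) (C p fp) (C p z) (C t fp) !hyp; split; ring.
have [U prU] : exists U, pr U != 0.
  apply: contrapT => H.
  have : (\dim {:V} <= \dim <<[:: p; t; fp; z]>>)%N.
    apply/dimvS/subvP => U _; have prU0 : pr U = 0.
      by apply/eqP/negPn/negP => U0; apply: H; exists U.
    have -> : U = w U fp *: p + w U z *: t - w U p *: fp - w U t *: z.
      apply: (omega_inj symp) => W; have := wpr U W; rewrite prU0 linear0l.
      rewrite !(linearDl, linearNl, linearZl_LR) /=; lra.
    by rewrite !(memvD, memvN, memvZ) // memv_span // !inE eqxx ?orbT.
  by rewrite dim6 leqNgt ltnS (leq_trans (dim_span _)).
have w_pr U' W : w p W = 0 -> w t W = 0 -> w fp W = 0 -> w z W = 0 -> w (pr U') W = w U' W.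
  by move=> H1 H2 H3 H4; rewrite wpr H1 H2 H3 H4; ring.
have pr0 A W : pr A = 0 -> w A fp = 0 -> w A z = 0 -> w fp W = 0 -> w z W = 0 -> w A W = 0.
  by move=> A0 A1 A2 W1 W2; have := wpr A W; rewrite A0 linear0l A1 A2 W1 W2; lra.
have br_H X Y : w (br X Y) fp = 0 /\ w (br X Y) z = 0.
  by rewrite fp_def linearZr_LR /= !iso mulr0.
have w0_H : w w0 fp = 0 /\ w w0 z = 0.
  rewrite fp_def linearZr_LR /= (C (br z x)) (C z) !w0E !t0E.
  by rewrite !Tc ?oppr0 ?mulr0 //; do ?[exact: br3]; rewrite -/z; apply: br3.
have br_w0 X Y : w (br X Y) w0 = 0.
  by rewrite w0E t0E Tc //; apply: br3.
(* A nonzero projection of a bracket is taken if there is one, otherwise that of [w0], and if this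
   vanishes too, the vector [pr U]. *)
have [fq [fq_neq0 fqH br_fq0 w0_fq]] : exists fq, [/\ fq != 0,
    [/\ w fq p = 0, w fq t = 0, w fq fp = 0 & w fq z = 0],
    forall X Y, w (br X Y) fq = 0 & w w0 fq = 0].
  have sw A B : w A B = 0 -> w B A = 0 by move=> AB; rewrite C AB oppr0.
  have [[X1 [Y1 n1]]|all0] := pselect (exists X Y, pr (br X Y) != 0).
    exists (pr (br X1 Y1)); have [h1 h2 h3 h4] := prH (br X1 Y1).
    split=> // [X Y|]; apply: (sw); rewrite wpr (br_H X1 Y1).1 (br_H X1 Y1).2.
      by rewrite iso (sw _ _ (br_H X Y).1) (sw _ _ (br_H X Y).2); ring.
    by rewrite br_w0 (sw _ _ w0_H.1) (sw _ _ w0_H.2); ring.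
  have br0 X Y : pr (br X Y) = 0.
    by apply/eqP/negPn/negP => H; apply: all0; exists X, Y.
  have [w00|n1] := eqVneq (pr w0) 0.
    exists (pr U); have [h1 h2 h3 h4] := prH U; split=> // [X Y|].
      by apply: pr0 => //; rewrite ?(br_H X Y).1 ?(br_H X Y).2 //; apply: (sw).
    by apply: pr0 => //; rewrite ?w0_H.1 ?w0_H.2 //; apply: (sw).
  exists (pr w0); have [h1 h2 h3 h4] := prH w0; split=> // [X Y|].
    by apply: pr0 => //; rewrite ?(br_H X Y).1 ?(br_H X Y).2 //; apply: (sw).
  by apply: (sw); rewrite wpr w0_H.1 w0_H.2 (omegaxx w) (sw _ _ w0_H.1) (sw _ _ w0_H.2); ring.
have [fq_p fq_t fq_fp fq_z] := fqH.
have [Q Q_fq] : exists Q, w Q fq != 0.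
  apply: contrapT => H; move/eqP: fq_neq0; apply; apply: (omega_nd symp) => Y.
  by rewrite C; apply/eqP; rewrite oppr_eq0; apply/negPn/negP => wY; apply: H; exists Y.
have [p_fq t_fq fp_fq z_fq] : [/\ w p fq = 0, w t fq = 0, w fp fq = 0 & w z fq = 0].
  by split; rewrite C ?fq_p ?fq_t ?fq_fp ?fq_z oppr0.
have [q q_def] : exists q, q = (w Q fq)^-1 *: pr Q by eexists.
have [q_p q_t q_fp q_z] : [/\ w q p = 0, w q t = 0, w q fp = 0 & w q z = 0].
  by have [h1 h2 h3 h4] := prH Q; rewrite q_def !linearZl_LR /= h1 h2 h3 h4 mulr0.
have q_fq : w q fq = 1.
  by rewrite q_def linearZl_LR /= w_pr // mulVf.
have D : darboux w p t q fp z fq.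
  by split=> //; rewrite C ?q_p ?q_t oppr0.
have E := darboux_values D; have dec := darboux_expand symp dim6 D.
have t0_t : t0 = - b *: t by rewrite t_def scalerA mulrNN mulfV // scale1r.
(* fq is central because the symmetric form S vanishes: by nilpotency S X u = 0 for
   every u as in flat_product_exists, and S Y Z is up to sign a coordinate of u. *)
pose S X Y := T fq X Y.
have Ssym X Y : S X Y = S Y X.
  have := symp.2 fq X Y; rewrite br_fq0 (brC lie fq Y) linearNl /= addr0.
  by move=> /eqP; rewrite subr_eq0 => /eqP.
have Sxx : S x x = 0 by rewrite /S -t0E t0_t linearZr_LR /= fq_t mulr0.
have br_fq_c X : central br (br fq X).
  have H := jacobi lie X fq x.
  have := congr1 (fun Y => w Y x) H; rewrite !linearDl linear0l /=.
  rewrite (brE X fq) (brE fq x) (brE x X) !linearZl_LR /= -/b.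
  (* Orthogonality of [fq] to [w0] enters here: T [fq,x] x x = w [fq,x] t0 = w fq w0. *)
  have -> : T (br fq x) x x = 0 by rewrite -t0E -w0E C w0_fq oppr0.
  rewrite (zsym fq x) br_fq0 mulr0 addr0 !mul0r addr0 divfK // => H0.
  have := genE X fq; rewrite H0 mul0r scale0r subr0 (brC lie X fq) => /centralN.
  by apply.
have Su X Y Z u : (forall W, w W u = T W Y Z) -> S X u = 0.
  by move=> uE; rewrite /S uE Tc //; apply: br_fq_c.
have St X : S X t = 0 by rewrite t_def /S linearZr_LR /= -/(S X t0) (Su X x x t0) ?mulr0.
have Sz X : S X z = 0.
  by rewrite Ssym /S (brC lie z fq) linearNl /= zsym br_fq0 oppr0.
have Sfp X : S X fp = 0 by rewrite Ssym /S (br_central_r lie fq fp_c) linear0l.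
have Sfq X : S X fq = 0 by rewrite Ssym /S (brxx lie) linear0l.
have SD X A B : S X (A + B) = S X A + S X B by rewrite /S linearDr.
have SZ X a A : S X (a *: A) = a * S X A by rewrite /S linearZr_LR.
have Sx X : S X x = S X p.
  have -> : x = p + w x z *: t + (- w x t) *: z.
    by apply: (omega_inj symp) => W; rewrite p_def !(linearDl, linearZl_LR) /=; ring.
  by rewrite !SD !SZ St Sz !mulr0 !addr0.
have Spp : S p p = 0 by rewrite -Sx Ssym -Sx Sxx.
have Sexp X u : S X u = w u fp * S X p + w u fq * S X q.
  rewrite {1}(dec u) -!scaleNr !SD !SZ St Sz Sfp Sfq; ring.
have Sqp : S q p = 0.
  (* For this [u], w u fq = - S q p, so S p u = 0 reads - (S q p)^2 = 0. *)
  have [u uE] := flat_product_exists q p.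
  have := Su p q p u uE; rewrite Sexp Spp mulr0 add0r (C fq u) uE -/(S q p) (Ssym p q).
  by move=> /eqP; rewrite mulNr oppr_eq0 mulf_eq0 orbb => /eqP.
have Sqq : S q q = 0.
  have [u uE] := flat_product_exists q q.
  have := Su q q q u uE; rewrite Sexp Sqp mulr0 add0r (C fq u) uE -/(S q q).
  by move=> /eqP; rewrite mulNr oppr_eq0 mulf_eq0 orbb => /eqP.
have fq_c : central br fq.
  move=> X; apply: (omega_nd symp) => Y; rewrite -/(S X Y) Sexp.
  rewrite (Ssym X p) (Ssym X q) (Sexp p X) (Sexp q X) Spp Sqp (Ssym p q) Sqp Sqq; ring.
have zt Y : T z Y t = 0.
  by rewrite t_def linearZr_LR /= t0E Tc ?mulr0 //; apply: br3.
have zz Y : T z Y z = 0 by rewrite zsym (brxx lie) linear0l.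
have zfp Y : T z Y fp = 0 by rewrite zsym (br_central_r lie z fp_c) linear0l.
have zfq Y : T z Y fq = 0 by rewrite zsym (br_central_r lie z fq_c) linear0l.
have zexp Y Z : T z Y Z = w Z fp * T z Y p + w Z fq * T z Y q.
  rewrite {1}(dec Z) !(linearDr, linearNr, linearZr_LR) /= zt zz zfp zfq; ring.
have zpp : T z p p = b.
  have zx Y : T z Y p = T z Y x.
    by rewrite p_def !linearDr !linearZr_LR /= zt zz !mulr0 !addr0.
  by rewrite zx zsym zx.
(* Completing the square: replacing [q] by [q - r *: p] makes the form w [z,.] . diagonal, and [fp]
   is adjusted to keep a Darboux basis. *)
pose r := T z p q / b.
exists p, t, (q - r *: p), (fp + r *: fq), z, fq, b, (T z q q - r * T z p q).
split=> //.
- split; rewrite ?(linearDl, linearDr, linearNl, linearNr, linearZl_LR, linearZr_LR) /= ?E; ring.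
- by move=> X Y; rewrite linearDr linearZr_LR /= (br_H X Y).1 br_fq0 mulr0 addr0.
- by move=> X Y; rewrite (br_H X Y).2.
- by move=> X; rewrite linearDl linearZl_LR fp_c fq_c scaler0 addr0.
- move=> Y Z; rewrite zexp (zsym Y p) (zsym Y q) !(zexp _ Y) zpp (zsym q p).
  rewrite !linearDr !linearZr_LR /= /r; by field.
Qed.
End Existence.

Theorem theorem2 (R : realType) (n : vectType R) (br : {bilinear n -> n -> n})
    (omega : {skew_symmetric n}) (g : {dot n for idfun}) :
  lie_bracket br ->
  \dim {:n} = 6%N ->
  step_nilpotent br 3 ->
  symplectic br omega ->
  minimal br omega g ->
  soliton br omega g.
Proof.
move=> lie dim6 [nil3 /(_ 2%N isT) c2] symp min.
have [p [t [q [fp [z [fq [b1 [b2 ad]]]]]]]] := adapted_exists lie nil3 symp dim6 c2.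
have [e eON] := orthonormal_basis_exists g.
have c0_neq0 : dot3 (br_coord br g e) (br_coord br g e) != 0.
  apply/eqP => /dot3_eq0 c0; have [X [Y]] := noncentral_bracket lie c2; apply=> Z.
  have br0 U W : br U W = 0.
    apply: (@dot_inj _ _ g) => A; rewrite linear0l (parseval_lin eON (f := br^~ W)); last first.
      by move=> a B B'; rewrite linearPl.
    rewrite big1 // => i _; rewrite (parseval_lin eON (f := br (e i))); last first.
      by move=> a B B'; rewrite linearPr.
    rewrite big1 ?mulr0 // => j _; rewrite [X in _ * X](parseval eON) big1 ?mulr0 // => k _.
    by rewrite -/(br_coord br g e i j k) c0 mul0r.
  by rewrite br0.
have [lambda lambdaE] := minimal_derivation lie nil3 eON min.1
  (adapted_dilation lie symp dim6 ad) min c0_neq0.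
apply: (soliton_of_derivation lie nil3 symp min.1 lambdaE).
have [theta [theta_lin theta0 thetaE]] := chern_ricci_functional g nil3 symp.
exact: (adapted_derivation lie symp dim6 ad theta_lin theta0 thetaE).
Qed.
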